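(* Let $r>0$, let $V\subset\mathbb{R}$ be compact, and let $M\in\mathcal{C}^0(V)$ be as in the context; put $v_{\max}=\sup V$. There exists a speed $c^*\in(0,v_{\max})$ such that for all $c\in[c^*,v_{\max})$ there exists a travelling wave $f(x-ct,v)$ with speed $c$ (in the sense of the context), so that the profile $f$ solves $$(v-c)\,\partial_z f=\big(M(v)\rho_f-f\big)+r\rho_f\big(M(v)-f\big),\qquad (z,v)\in\mathbb{R}\times V.$$ The travelling wave is nonincreasing with respect to the space variable: $\partial_zf\le0$. Moreover, if $\inf_V M>0$, then there exists no positive travelling wave of speed $c\in[0,c^* )$.
   Context: The set $V\subset\mathbb{R}$ is compact and symmetric ($V=-V$), $V=\operatorname{supp}M$, and $M:V\to[0,\infty)$ is continuous with $\int_V M(v)\,dv=1$, $\int_V vM(v)\,dv=0$, $\int_V v^2M(v)\,dv=D<+\infty$. For a function $g(t,x,v)$, $\rho_g(t,x)=\int_V g(t,x,v)\,dv$, and likewise $\rho_f(z)=\int_V f(z,v)\,dv$ for $f(z,v)$. The underlying equation is $$\partial_t g+v\,\partial_xg=\big(M(v)\rho_g-g\big)+r\rho_g\big(M(v)-g\big),\qquad (t,x,v)\in\mathbb{R}_+\times\mathbb{R}\times V.$$ A function $g(t,x,v)$ is a (smooth) travelling wave solution of speed $c\in\mathbb{R}_+$ of this equation if it is a solution that can be written $g(t,x,v)=f(x-ct,v)$, where the profile $f\in\mathcal{C}^2(\mathbb{R}\times V)$ satisfies, for all $(z,v)\in\mathbb{R}\times V$, $$0\le f(z,v)\le M(v),\qquad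 \lim_{z\to-\infty}f(z,v)=M(v),\qquad \lim_{z\to+\infty}f(z,v)=0 .$$ Equivalently, $f$ solves the stationary equation displayed in the claim. It is positive if $f(z,v)>0$ for all $(z,v)\in\mathbb{R}\times V$.
   Formalization: The profile is required to be C² in z only, with f, ∂_z f and ∂_zz f jointly continuous on R×V, instead of f ∈ C²(R×V): since M is only continuous and V an arbitrary compact set, C² regularity in v is false or undefined in general (f is M(v) times a smooth function). *)

(* Defs.v *)
From HB Require Import structures.
From mathcomp Require Export all_boot all_order all_algebra.
From mathcomp Require Export all_classical all_reals all_analysis.
Export Order.TTheory GRing.Theory Num.Theory.
Export numFieldNormedType.Exports.

#[export] Set Implicit Arguments.
#[export] Unset Strict Implicit.
#[export] Unset Printing Implicit Defensive.

Local Open Scope classical_set_scope.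
Local Open Scope ring_scope.

(* Functions on V, R * V and R_+ * R * V are represented by total functions of
   real variables; their values at velocities outside V are never used. *)

(* The support is the topological one: closure of the nonvanishing set. *)
Definition supp_on (R : realType) (V : set R) (M : R -> R) : set R :=
  closure [set v | V v /\ M v != 0].

Definition density (R : realType) (V : set R) (h : R -> R) : R :=
  \int[@lebesgue_measure R]_(v in V) h v.

Definition kinetic_rhs (R : realType) (r : R) (V : set R) (M h : R -> R)
    (v : R) : R :=
  (M v * density V h - h v) + r * density V h * (M v - h v).

(* d_t g + v d_x g = (M rho_g - g) + r rho_g (M - g) on R_+ * R * V, in the
   classical sense.  At t = 0 the t-derivative is that of the total function. *)
Definition kinetic_solution (R : realType) (r : R) (V : set R) (M : R -> R)
    (g : R -> R -> R -> R) : Prop :=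
  forall t x v : R, 0 <= t -> V v ->
    [/\ derivable (fun s => g s x v) t 1,
        derivable (fun y => g t y v) x 1 &
        derive1 (fun s => g s x v) t + v * derive1 (fun y => g t y v) x
          = kinetic_rhs r V M (g t x) v].

Definition dz (R : realType) (f : R -> R -> R) : R -> R -> R :=
  fun z v => derive1 (fun y => f y v) z.

Definition jointly_continuous (R : realType) (V : set R) (f : R -> R -> R)
    : Prop :=
  {within [set p : R * R | V p.2], continuous (fun p : R * R => f p.1 p.2)}.

(* C^2 regularity of a profile on R * V.  The equation contains no
   v-derivative, V is an arbitrary compact set and M is only continuous, so the
   differentiability is in z; f and its z-derivatives of order 1 and 2 are
   continuous in the pair (z, v) on R * V.  Differentiability in v cannot be
   required: a travelling wave is M(v) times a smooth positive function of
   (z, v), hence is no more regular in v than M is. *)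
Definition C2_profile (R : realType) (V : set R) (f : R -> R -> R) : Prop :=
  [/\ forall z v : R, V v -> derivable (fun y => f y v) z 1,
      forall z v : R, V v -> derivable (fun y => dz f y v) z 1,
      jointly_continuous V f,
      jointly_continuous V (dz f) &
      jointly_continuous V (dz (dz f))].

Definition travelling_wave (R : realType) (r : R) (V : set R) (M : R -> R)
    (c : R) (f : R -> R -> R) : Prop :=
  [/\ 0 <= c,
      C2_profile V f,
      forall z v : R, V v -> 0 <= f z v <= M v,
      forall v : R, V v -> f z v @[z --> -oo] --> M v
                        /\ f z v @[z --> +oo] --> (0 : R) &
      kinetic_solution r V M (fun t x v => f (x - c * t) v)].

Definition profile_equation (R : realType) (r : R) (V : set R) (M : R -> R)
    (c : R) (f : R -> R -> R) : Prop :=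
  forall z v : R, V v -> (v - c) * dz f z v = kinetic_rhs r V M (f z) v.

Definition positive_profile (R : realType) (V : set R) (f : R -> R -> R)
    : Prop :=
  forall z v : R, V v -> 0 < f z v.

(* Main.v *)
Require Import Defs.
From mathcomp Require Import measurable_realfun ring lra.
Local Open Scope classical_set_scope.
Local Open Scope ring_scope.

(** Write a profile as f = M (1 - h) and put p = 1 - rho_f, so that p is the
    average of h with weight M.  For each velocity the profile equation becomes

      (v - c) h' + (1 + r - r p) h = p,

    which is linear in h once p is given.  By the maximum principle it has
    exactly one solution with values in [0, 1], the [response] to p; it
    increases with p and, when p is nondecreasing, it decreases in v - c.
    Averaging the responses over the velocities gives a monotone, translation
    invariant map on nondecreasing functions p, [front_map] at speed c, written T
    here, and the monotone travelling waves correspond to its nonconstant fixed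
    points.  A constant l is mapped to l / (1 + r - r l), so l <= T l only for
    l = 0 and l = 1; this forces the limits at both ends.

    The critical speed is the least c in [0, sup V) for which there is a
    nondecreasing fixed point with p 0 = 1/2, called a [wave] below.  What makes
    this work, in the spirit of Weinberger's theory of monotone recursions, is
    [wave_of_sub_front]: a nondecreasing q with q <= T q, q -> 0 at -oo and
    q <> 0 is enough to produce a wave.  The largest sub-front below an
    obstacle of height 1 - k is a fixed point up to an error k; translating it
    so that it takes the value 1/2 at 0 and letting k -> 0, compactness gives
    the wave.  It follows that
    - the set of speeds is upward closed, because the front map increases with c,
      so that a wave of speed c is a sub-front at larger speeds
      ([wave_speed_up]);
    - it contains its infimum, by the same compactness ([wave_speed_closed]);
    - it is not empty, because max (0, 1 - exp (- l z)) is a sub-front for c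
      close to sup V and l large ([wave_near_max_speed]);
    - it does not contain 0: at speed 0 the flux, the average of v h, has
      derivative - r p (1 - p) and vanishes at both ends ([no_wave_zero]);
    - it contains the speed of every travelling wave f: the running supremum
      sup_(y <= z) p y is a sub-front ([sub_front_of_travelling_wave]), which is
      why no travelling wave is slower than the critical speed.

    Compactness and regularity both come from one averaging effect.  A solution
    of (v - c) u' + k u = S is Lipschitz in z with constant of order
    1 / |v - c|, hence Hoelder of exponent 1/2 with constant of order
    |v - c|^(-1/2), which is integrable in v: averages over v gain half a
    derivative.  If S is Hoelder of exponent 1/2, then the residual
    S - k u = (v - c) u' is of order |v - c|^(1/2) and so u' is of order
    |v - c|^(-1/2): the average of u is differentiable.  Two rounds of this
    ([wave_regularity]) show that h is of class C^2 in z, with derivatives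
    jointly continuous across the degenerate velocity v = c. *)

(** * Calculus on the line *)

Section RealAnalysis.
Context {R : realType}.
Implicit Types (f g p : R -> R) (x y z : R).
Notation mu := (@lebesgue_measure R).

Lemma is_derive_continuous f x d : is_derive x 1 f d -> {for x, continuous f}.
Proof.
by move=> [h _]; apply: differentiable_continuous; exact/derivable1_diffP.
Qed.

Lemma derivable_is_derive f x : derivable f x 1 -> is_derive x 1 f (derive1 f x).
Proof. by move=> h; rewrite derive1E; exact: DeriveDef. Qed.

Lemma derD f g (z df dg : R) : is_derive z 1 f df -> is_derive z 1 g dg ->
  is_derive z 1 (fun x => f x + g x) (df + dg).
Proof. by move=> hf hg; exact: is_deriveD. Qed.

Lemma derN f (z df : R) : is_derive z 1 f df ->
  is_derive z 1 (fun x => - f x) (- df).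
Proof. by move=> hf; exact: is_deriveN. Qed.

Lemma derB f g (z df dg : R) : is_derive z 1 f df -> is_derive z 1 g dg ->
  is_derive z 1 (fun x => f x - g x) (df - dg).
Proof. by move=> hf hg; exact: is_deriveB. Qed.

Lemma derM f g (z df dg : R) : is_derive z 1 f df -> is_derive z 1 g dg ->
  is_derive z 1 (fun x => f x * g x) (f z * dg + df * g z).
Proof.
move=> hf hg; apply: (is_derive_eq (is_deriveM hf hg)).
by rewrite ![_ *: _]/(_ * _) (mulrC df).
Qed.

Lemma der_cst (c z : R) : is_derive z 1 (fun _ : R => c) 0.
Proof. exact: is_derive_cst. Qed.

Lemma der_id (z : R) : is_derive z 1 (fun x : R => x) 1.
Proof. exact: is_derive_id. Qed.

Lemma derMl f (c z df : R) : is_derive z 1 f df ->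
  is_derive z 1 (fun x => c * f x) (c * df).
Proof. by move=> hf; apply: (is_derive_eq (derM (der_cst c z) hf)); rewrite mul0r addr0. Qed.

Lemma derMr f (c z df : R) : is_derive z 1 f df ->
  is_derive z 1 (fun x => f x * c) (df * c).
Proof. by move=> hf; apply: (is_derive_eq (derM hf (der_cst c z))); rewrite mulr0 add0r. Qed.

Lemma derDc f (c z df : R) : is_derive z 1 f df ->
  is_derive z 1 (fun x => f x + c) df.
Proof. by move=> hf; apply: (is_derive_eq (derD hf (der_cst c z))); rewrite addr0. Qed.

Lemma derBc f (c z df : R) : is_derive z 1 f df ->
  is_derive z 1 (fun x => f x - c) df.
Proof. exact: derDc. Qed.

Lemma der_comp f g (z df dg : R) : is_derive (g z) 1 f df -> is_derive z 1 g dg ->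
  is_derive z 1 (fun x => f (g x)) (df * dg).
Proof. by move=> hf hg; exact: (@is_derive1_comp R f g z df dg). Qed.

Lemma der_reflect f (z d : R) : is_derive (- z) 1 f d ->
  is_derive z 1 (fun x => f (- x)) (- d).
Proof.
move=> hd; apply: (is_derive_eq (@der_comp f (fun x => - x) z d (-1) hd (derN (der_id z)))).
by rewrite mulrN1.
Qed.

Lemma der_expR f (z d : R) : is_derive z 1 f d ->
  is_derive z 1 (fun x => expR (f x)) (expR (f z) * d).
Proof. by move=> h; apply: (@is_derive1_comp R expR f). Qed.

Lemma der_shift f (z t d : R) : is_derive (z + t) 1 f d ->
  is_derive z 1 (fun x => f (x + t)) d.
Proof.
by move=> hd; apply: (is_derive_eq (@der_comp f (fun x => x + t) z d 1 hd (derDc t (der_id z))));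
  rewrite mulr1.
Qed.

Lemma der_unique f (z d1 d2 : R) : is_derive z 1 f d1 -> is_derive z 1 f d2 -> d1 = d2.
Proof. by move=> h1 h2; rewrite -(@derive_val _ _ _ _ _ _ _ h1) (@derive_val _ _ _ _ _ _ _ h2). Qed.

Lemma le_of_derive_le0 f x y : x <= y ->
  (forall t, x <= t <= y -> exists2 d : R, is_derive t 1 f d & d <= 0) ->
  f y <= f x.
Proof.
move=> xy H.
pose df t := 'D_1 f t.
have D (t : R) : x <= t <= y -> is_derive t 1 f (df t) /\ df t <= 0.
  move=> /H[d hd d0]; split; first by apply: DeriveDef; case: hd.
  by rewrite /df (@derive_val _ _ _ _ _ _ _ hd).
have [|| t + e] := @MVT_segment R f df x y xy.
- by move=> t /[!in_itv]/= /andP[a b]; apply: (D t _).1; rewrite !ltW.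
- apply: derivable_within_continuous => t /[!in_itv]/= h.
  by case: (D t h).1.
- rewrite in_itv/= => /D[_ h]; rewrite -subr_le0 e.
  by rewrite mulr_le0_ge0// subr_ge0.
Qed.

Lemma ge0_of_derive_nondecreasing f (z d : R) : {homo f : x y / x <= y} ->
  is_derive z 1 f d -> 0 <= d.
Proof.
move=> fnd hd; rewrite -(@derive_val _ _ _ _ _ _ _ hd).
apply: limr_ge; first by case: hd.
near=> h.
rewrite /= scaler1 [_ *: _]/(_ * _).
have h0 : h != 0 by near: h; exact: nbhs_dnbhs_neq.
have [h1|h1] := leP 0 h.
  by rewrite mulr_ge0 ?invr_ge0// subr_ge0 fnd// lerDr.
by rewrite mulr_le0// ?invr_le0 ?(ltW h1)// subr_le0 fnd// gerDr ltW.
Unshelve. all: end_near. Qed.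

Lemma MVT_is_derive f df x y : x <= y ->
  (forall t, x <= t <= y -> is_derive t 1 f (df t)) ->
  exists2 t, x <= t <= y & f y - f x = df t * (y - x).
Proof.
move=> xy D.
have [|| t + e] := @MVT_segment R f df x y xy.
- by move=> t /[!in_itv]/= /andP[a b]; apply: D; rewrite !ltW.
- apply: derivable_within_continuous => t /[!in_itv]/= h.
  by case: (D t h).
- by rewrite in_itv/= => h; exists t.
Qed.

Lemma lipschitz_of_derive f (B : R) :
  (forall t : R, exists2 d : R, is_derive t 1 f d & `|d| <= B) ->
  forall x y, `|f x - f y| <= B * `|x - y|.
Proof.
move=> H.
have D (t : R) : is_derive t 1 f ('D_1 f t) /\ `|'D_1 f t| <= B.
  have [d hd d0] := H t; split; first by apply: DeriveDef; case: hd.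
  by rewrite (@derive_val _ _ _ _ _ _ _ hd).
move=> x y; wlog xy : x y / y <= x => [W|].
  have [/W//|/ltW/W] := leP y x.
  by rewrite (distrC (f y)) (distrC y).
have [t _ ->] := MVT_is_derive xy (fun t _ => (D t).1).
by rewrite normrM ler_wpM2r// (D t).2.
Qed.

(** The integral from - n is a primitive to the right of - n only.  At each x a base
    point below x is used, and the integral is renormalized to vanish at 0, which
    makes it independent of the base point. *)
Lemma continuous_primitive p : continuous p ->
  exists P : R -> R, forall z, is_derive z 1 P (p z).
Proof.
move=> cp.
have ip a b : mu.-integrable `[a, b] (EFin \o p).
  apply: continuous_compact_integrable; first exact: segment_compact.
  exact: continuous_subspaceT.
pose F (n : nat) x := \int[mu]_(t in `[- n%:R, x]) p t.
have FB (m n : nat) x y : (m <= n)%N -> - m%:R <= x -> - m%:R <= y ->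
    F n x - F n y = F m x - F m y.
  move=> mn.
  have K u : - m%:R <= u -> F n u - F n (- m%:R) = F m u.
    move=> mu0; rewrite /F Rintegral_itvB ?bnd_simp//=.
      rewrite Rintegral_itv_obnd_cbnd//.
      by apply: integrableS (ip (- m%:R) u) => //; apply: subset_itvr; rewrite bnd_simp.
    by rewrite lerN2 ler_nat.
  move=> /K <- /K <-; lra.
pose N (x : R) := (Num.trunc `|x|).+1.
have NP x : - (N x)%:R < x.
  have := truncnS_gt `|x|; rewrite /N => h.
  by rewrite ltrNl (le_lt_trans _ h)// -normrN ler_norm.
exists (fun x => F (N x) x - F (N x) 0) => z.
pose n := (N z); pose P0 x := F n x - F n 0.
have dF : is_derive z 1 (F n) (p z).
  have [] := @continuous_FTC1_closed R p (- n%:R) z (z + 1) _ (ip _ _) _ (cp z).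
  - by rewrite ltrDl.
  - exact: NP.
  move=> h1 h2; rewrite -h2; exact: derivable_is_derive.
have dP0 : is_derive z 1 P0 (p z).
  rewrite -[p z]subr0; exact: is_deriveB.
apply: (near_eq_is_derive _ dP0).
near=> x.
have xn : - n%:R < x.
  by near: x; exact: lt_nbhsr (NP z).
rewrite /P0.
have m0 (m : nat) : - m%:R <= 0 :> R by rewrite oppr_le0.
case: (leqP (N x) n) => h; first by apply: FB => //; exact: ltW (NP x).
by apply/esym/FB => //; [exact: ltnW|exact: ltW].
Unshelve. all: end_near. Qed.

Lemma expRN_inv_lt (e : R) : 0 < e -> expR (- e^-1) < e.
Proof.
move=> e0; rewrite expRN -[ltRHS]invrK ltf_pV2 ?posrE ?expR_gt0 ?invr_gt0//.
by apply: lt_le_trans (expR_ge1Dx _); rewrite ltrDr.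
Qed.

End RealAnalysis.

(** * The maximum principle for a u' + k u *)

Section Transport.
Context {R : realType}.
Implicit Types (a s B A L : R) (k p w u h S K : R -> R) (x y z : R).

(** With K' = k, the function exp (K / a) (w - s) is nonincreasing on [z - A, z]
    because k s >= s, and K grows at least by A there: the value B at the far
    end is damped by exp (- A / a). *)
Lemma max_principle_local_pos a s B A k w z : 0 < a -> 0 <= s -> 0 <= B ->
  0 <= A -> continuous k -> (forall y, 1 <= k y) ->
  (forall y, z - A <= y <= z ->
     exists2 d : R, is_derive y 1 w d & a * d + k y * w y <= s) ->
  w (z - A) <= B -> w z <= s + B * expR (- (A / a)).
Proof.
move=> a0 s0 B0 A0 ck k1 H wB.
have [K dK] := continuous_primitive ck.
have zA : z - A <= z by rewrite gerBl.
have KA : A <= K z - K (z - A).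
  have [t _ ->] := MVT_is_derive zA (fun t _ => dK t).
  have -> : z - (z - A) = A by ring.
  by rewrite ler_peMl.
pose F y := expR (K y / a) * (w y - s).
have FF : F z <= F (z - A).
  apply: le_of_derive_le0 => // t /H[d dw hd].
  exists (expR (K t / a) * (a^-1 * (a * d + k t * w t - k t * s))).
    apply: (is_derive_eq (derM (der_expR (derMr a^-1 (dK t))) (derBc s dw))).
    by field; exact: lt0r_neq0.
  rewrite mulr_ge0_le0 ?expR_ge0// mulr_ge0_le0 ?invr_ge0 ?(ltW a0)//.
  have : 1 * s <= k t * s by rewrite ler_wpM2r.
  lra.
have [ws|ws] := leP (w z) s.
  by rewrite (le_trans ws)// lerDl mulr_ge0// expR_ge0.
rewrite -lerBlDl.
have e1 : w z - s <= expR (- ((K z - K (z - A)) / a)) * (w (z - A) - s).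
  have -> : - ((K z - K (z - A)) / a) = K (z - A) / a - K z / a by field; exact: lt0r_neq0.
  by rewrite expRB mulrAC ler_pdivlMr ?expR_gt0// mulrC.
apply: (le_trans e1).
have e2 : expR (- ((K z - K (z - A)) / a)) <= expR (- (A / a)).
  by rewrite ler_expR lerN2 ler_pM2r ?invr_gt0.
apply: (@le_trans _ _ (expR (- ((K z - K (z - A)) / a)) * B)).
  by rewrite ler_wpM2l ?expR_ge0//; lra.
by rewrite mulrC ler_wpM2l.
Qed.

(** The case a < 0 is the reflection of a > 0, and for a = 0 the hypothesis is
    already pointwise.  Derivatives are given by an existential d, constrained
    only for a <> 0, so that the velocity v = c is covered by the same
    statements.  The rate of decay is uniform for |a| <= L. *)
Lemma max_principle_local a s B A L k w z :
  `|a| <= L -> 0 < L -> 0 <= s -> 0 <= B ->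
  0 <= A -> continuous k -> (forall y, 1 <= k y) ->
  (forall y, `|y - z| <= A ->
     exists2 d : R, (a != 0 -> is_derive y 1 w d) & a * d + k y * w y <= s) ->
  (forall y, w y <= B) -> w z <= s + B * expR (- (A / L)).
Proof.
move=> aL L0 s0 B0 A0 ck k1 H wB.
have W e : 0 < e <= L -> w z <= s + B * expR (- (A / e)) ->
    w z <= s + B * expR (- (A / L)).
  move=> /andP[e0 eL] /le_trans; apply.
  rewrite lerD2l ler_wpM2l// ler_expR lerN2 ler_wpM2l//.
  by rewrite lef_pV2.
have [a0|a0|a0] := ltgtP a 0.
- apply: (W (- a)); first by rewrite oppr_gt0 a0 -ltr0_norm//.
  rewrite -[z]opprK.
  have cN : continuous (fun x => k (- x)).
    by move=> x; apply: continuous_comp; [exact: opp_continuous|exact: ck].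
  apply: (@max_principle_local_pos (- a) s B A (fun x => k (- x))
    (fun x => w (- x)) (- z)) => //.
  - by rewrite oppr_gt0.
  - move=> y yz; have [|d hd hs] := H (- y).
      by rewrite ler_norml; apply/andP; split; lra.
    exists (- d); last by rewrite mulrNN.
    by apply/der_reflect/hd; rewrite lt_eqF.
- apply: (W a); first by rewrite a0 -[X in X <= _]gtr0_norm.
  apply: (@max_principle_local_pos a s B A k w z) => // y yz.
  have [|d hd hs] := H y; first by rewrite ler_norml; apply/andP; split; lra.
  by exists d => //; apply: hd; rewrite gt_eqF.
- have [|d _] := H z; first by rewrite subrr normr0.
  rewrite a0 mul0r add0r => h.
  apply: (@le_trans _ _ s); last by rewrite lerDl mulr_ge0// expR_ge0.
  have [w0|w0] := leP (w z) 0; first exact: le_trans s0.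
  by apply: le_trans h; rewrite ler_peMl// ltW.
Qed.

(** Let the radius A of the local version tend to infinity. *)
Lemma max_principle a s B k w : 0 <= s ->
  continuous k -> (forall y, 1 <= k y) ->
  (forall y, exists2 d : R, (a != 0 -> is_derive y 1 w d) & a * d + k y * w y <= s) ->
  (forall y, w y <= B) -> forall z, w z <= s.
Proof.
move=> s0 ck k1 H wB z.
rewrite leNgt; apply/negP => ws.
pose B' := Num.max B 1.
have B0 : 0 < B' by rewrite lt_max ltr01 orbT.
pose L := `|a| + 1.
have L0 : 0 < L by rewrite ltr_wpDl.
pose e := (w z - s); have e0 : 0 < e by rewrite subr_gt0.
(* With this radius exp (- A / L) < e / B', so the far value contributes less
   than the excess e. *)
pose A := L * (B' / e).
have := @max_principle_local a s B' A L k w z.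
have A0 : 0 <= A by rewrite /A mulr_ge0 ?divr_ge0// ltW.
move=> /(_ _ L0 s0 (ltW B0) A0 ck k1 (fun y _ => H y)) => h.
have {}h : w z <= s + B' * expR (- (A / L)).
  by apply: h; [rewrite lerDl|move=> y; rewrite le_max wB].
move: h; rewrite /A mulrAC divff ?gt_eqF// mul1r => h.
have h1 : expR (- (B' / e)) < e / B'.
  by rewrite -[B' / e]invf_div expRN_inv_lt// divr_gt0.
have : B' * expR (- (B' / e)) < e.
  by rewrite mulrC -ltr_pdivlMr.
rewrite /e in h *; lra.
Qed.

Lemma max_principle_abs a s B k w :
  continuous k -> (forall y, 1 <= k y) ->
  (forall y, exists2 d : R, (a != 0 -> is_derive y 1 w d) & `|a * d + k y * w y| <= s) ->
  (forall y, `|w y| <= B) -> forall z, `|w z| <= s.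
Proof.
move=> ck k1 H wB z.
have s0 : 0 <= s by have [d _ /(le_trans (normr_ge0 _))] := H 0.
rewrite ler_norml lerNl; apply/andP; split.
- apply: (@max_principle a s B k (fun x => - w x)) => // y; last first.
    by rewrite (le_trans _ (wB y))// -normrN ler_norm.
  have [d hd /ler_normlP[h1 h2]] := H y.
  exists (- d); last by rewrite !mulrN -opprD.
  by move=> a0; apply: derN; exact: hd.
- apply: (@max_principle a s B k w) => // y; last first.
    by rewrite (le_trans _ (wB y))// ler_norm.
  have [d hd /ler_normlP[h1 h2]] := H y; by exists d.
Qed.

(** For a > 0, with E = exp (K / a) and G a primitive of E p / a, both G and
    E - G are nondecreasing since 0 <= p <= 1 <= k.  Hence G is bounded below
    and h = (G - inf G) / E lies in [0, 1]. *)
Lemma transport_solution_exists a k p : continuous k -> continuous p ->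
  (forall y, 1 <= k y) -> (forall y, 0 <= p y <= 1) ->
  exists h, forall z, 0 <= h z <= 1 /\
    exists2 d : R, (a != 0 -> is_derive z 1 h d) & a * d + k z * h z = p z.
Proof.
wlog a0 : a k p / 0 <= a => [W|].
  have [a0|a0] := leP 0 a; first exact: W.
  move=> ck cp k1 p1.
  have cN (q : R -> R) : continuous q -> continuous (fun x : R => q (- x) : R).
    by move=> cq x; apply: continuous_comp; [exact: opp_continuous|exact: cq].
  have [|h H] := W (- a) (fun x => k (- x)) (fun x => p (- x)) _ (cN _ ck) (cN _ cp)
      (fun y => k1 _) (fun y => p1 _).
    by rewrite oppr_ge0 ltW.
  exists (fun x => h (- x)) => z; split; first exact: (H (- z)).1.
  have [_ [d hd e]] := H (- z).
  exists (- d); last by rewrite -[in RHS](opprK z) -e/= opprK mulrN mulNr.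
  by move=> h0; apply/der_reflect/hd; rewrite oppr_eq0.
move=> ck cp k1 p1.
have [a0'|a0'] := eqVneq a 0.
  exists (fun z => p z / k z) => z.
  have kz : 0 < k z := lt_le_trans ltr01 (k1 z).
  have /andP[p0 p11] := p1 z.
  split.
    by rewrite divr_ge0 ?(ltW kz)//= ler_pdivrMr// mul1r (le_trans p11).
  exists 0; first by [].
  by rewrite mulr0 add0r mulrC divfK// gt_eqF.
have {a0 a0'} a0 : 0 < a by rewrite lt_def a0' a0.
have [K dK] := continuous_primitive ck.
have dKa z : is_derive z 1 (fun y => K y / a) (k z / a) := derMr a^-1 (dK z).
pose E y := expR (K y / a).
have dE z : is_derive z 1 E (E z * (k z / a)) := der_expR (dKa z).
have cEp : continuous (fun y => E y * (p y / a)).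
  move=> z; apply: cvgM; first exact: is_derive_continuous (dE z).
  by apply: cvgM; [exact: cp|exact: cvg_cst].
have [G dG] := continuous_primitive cEp.
have E0 z : 0 < E z := expR_gt0 _.
have Gnd x y : x <= y -> G x <= G y.
  move=> xy; rewrite -lerN2; apply: (@le_of_derive_le0 R (fun t => - G t)) => // t _.
  exists (- (E t * (p t / a))); first exact: derN.
  have /andP[pt _] := p1 t.
  by rewrite oppr_le0 mulr_ge0 ?divr_ge0 ?(ltW a0) ?(ltW (E0 t)).
have GE x y : x <= y -> G y - E y <= G x - E x.
  move=> xy; apply: (@le_of_derive_le0 R (fun t => G t - E t)) => // t _.
  exists (E t * (p t / a) - E t * (k t / a)); first exact: derB.
  rewrite -mulrBr mulr_ge0_le0 ?(ltW (E0 t))// -mulrBl.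
  rewrite mulr_le0_ge0 ?invr_ge0 ?(ltW a0)// subr_le0.
  by case/andP: (p1 t) => _ /le_trans; apply.
pose g0 := inf (range G).
have Glb z y : G z - E z <= G y.
  have [xy|xy] := leP y z.
    by have := GE _ _ xy; have := E0 y; lra.
  by have := Gnd _ _ (ltW xy); have := E0 z; lra.
have g0le z : g0 <= G z.
  apply: ge_inf; last by exists z.
  by exists (G 0 - E 0) => _ [y _ <-].
have g0ge z : G z - E z <= g0.
  apply: lb_le_inf; first by exists (G 0), 0.
  by move=> _ [y _ <-].
exists (fun z => (G z - g0) / E z) => z; split.
  rewrite divr_ge0 ?subr_ge0 ?g0le ?(ltW (E0 z))//= ler_pdivrMr// mul1r.
  by have := g0ge z; lra.
exists ((p z - k z * ((G z - g0) / E z)) / a); last first.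
  by field; rewrite !gt_eqF.
move=> _.
have -> : (fun z => (G z - g0) / E z) = (fun z => (G z - g0) * expR (- (K z / a))).
  by apply/funext => y; rewrite /E expRN.
apply: (is_derive_eq (derM (derBc g0 (dG z)) (der_expR (derN (dKa z))))).
rewrite expRN -/(E z).
by field; rewrite !gt_eqF.
Qed.

End Transport.

(** * The response of one velocity to a given density *)

Section Response.
Context {R : realType}.
Variable r : R.
Hypothesis r_gt0 : 0 < r.
Implicit Types (a s B A L e l : R) (p q h g : R -> R) (x y z : R).

Definition unit_valued p := forall z : R, 0 <= p z <= 1.

Definition rate p (z : R) : R := 1 + r - r * p z.

(** This is the equation of h = 1 - f / M at relative velocity a = v - c, where
    p = 1 - rho_f; for a = 0 it is the algebraic relation rate p * h = p. *)
Definition is_response a p h := forall z : R, 0 <= h z <= 1 /\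
  exists2 d : R, (a != 0 -> is_derive z 1 h d) & a * d + rate p z * h z = p z.

Definition response a p : R -> R := xget (fun=> 0) [set h | is_response a p h].

Lemma rate_ge1 p : unit_valued p -> forall y, 1 <= rate p y.
Proof.
move=> p1 y; rewrite /rate; have /andP[_ h] := p1 y.
have : r * p y <= r * 1 by rewrite ler_wpM2l// ltW.
lra.
Qed.

Lemma rate_bounds p y : unit_valued p -> 0 <= rate p y <= 1 + r.
Proof.
move=> p1; have := rate_ge1 p1 y; rewrite /rate; have /andP[h _] := p1 y.
have : 0 <= r * p y by rewrite mulr_ge0// ltW.
by move=> ? ?; apply/andP; split; lra.
Qed.

Lemma rate_continuous p : continuous p -> continuous (rate p).
Proof.
move=> cp x; apply: cvgB; first exact: cvg_cst.
by apply: cvgM; [exact: cvg_cst|exact: cp].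
Qed.

Lemma responseP a p : continuous p -> unit_valued p ->
  is_response a p (response a p).
Proof.
move=> cp p1; apply: (@xgetPex _ _ [set h | is_response a p h]).
exact: (transport_solution_exists a (rate_continuous cp) cp (rate_ge1 p1) p1).
Qed.

(** The maximum principle is applied to g - h, which is bounded above; this allows
    exponential barriers that are unbounded below. *)
Lemma sub_response_le a p g h B : continuous p -> unit_valued p ->
  is_response a p h -> (forall y, g y <= B) ->
  (forall y, exists2 d : R, (a != 0 -> is_derive y 1 g d) &
     a * d + rate p y * g y <= p y) ->
  forall z, g z <= h z.
Proof.
move=> cp p1 hh gB hg z; rewrite -subr_le0.
apply: (@max_principle R a 0 B (rate p) (fun z => g z - h z)) => //.
- exact: rate_continuous.
- exact: rate_ge1.
- move=> y; have [d hd e1] := hg y; have [_ [d' hd' e2]] := hh y.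
  exists (d - d'); first by move=> a0; exact: derB (hd a0) (hd' a0).
  lra.
- by move=> y; have /andP[h0 _] := (hh y).1; have := gB y; lra.
Qed.

(** h1 is a sub-solution of the second equation because (p2 - p1) (1 + r h1) is
    nonnegative. *)
Lemma response_le a p1 p2 h1 h2 : continuous p2 -> unit_valued p2 ->
  is_response a p1 h1 -> is_response a p2 h2 ->
  (forall y, p1 y <= p2 y) -> forall z, h1 z <= h2 z.
Proof.
move=> c2 u2 H1 H2 p12.
apply: (@sub_response_le a p2 h1 h2 1) => //.
  by move=> y; case/andP: (H1 y).1.
move=> y; have [/andP[h0 h01] [d hd e]] := H1 y; exists d => //.
have : 0 <= (p2 y - p1 y) * (1 + r * h1 y).
  by rewrite mulr_ge0 ?subr_ge0// addr_ge0// mulr_ge0// ltW.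
move: e; rewrite /rate; lra.
Qed.

Lemma response_unique a p h1 h2 : continuous p -> unit_valued p ->
  is_response a p h1 -> is_response a p h2 -> h1 = h2.
Proof.
by move=> c u H1 H2; apply/funext => z; apply/le_anti/andP; split;
  apply: (@response_le a p p).
Qed.

Lemma is_response_shift a p h t : is_response a p h ->
  is_response a (fun z => p (z + t)) (fun z => h (z + t)).
Proof.
move=> H z; have [? [d hd e]] := H (z + t); split => //; exists d => //.
by move=> /hd; exact: der_shift.
Qed.

Lemma continuous_shift (T : topologicalType) (p : R -> T) t :
  continuous p -> continuous (fun z => p (z + t)).
Proof.
move=> cp z; apply: (@continuous_comp _ _ _ (fun z => z + t) p); last exact: cp.
by apply: cvgD; [exact: cvg_id|exact: cvg_cst].
Qed.

Lemma response_shift a p t z : continuous p -> unit_valued p ->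
  response a (fun z => p (z + t)) z = response a p (z + t).
Proof.
move=> cp up.
have cp' := @continuous_shift _ p t cp.
have up' : unit_valued (fun z => p (z + t)) by move=> y; exact: up.
by rewrite (response_unique cp' up' (responseP a cp' up')
  (is_response_shift t (responseP a cp up))).
Qed.

(** Compare the response with its translate: the data are ordered. *)
Lemma response_nondecreasing a p h : continuous p -> unit_valued p ->
  {homo p : x y / x <= y} -> is_response a p h -> {homo h : x y / x <= y}.
Proof.
move=> cp up pnd H x y xy.
have -> : y = x + (y - x) by ring.
have cp' := @continuous_shift _ p (y - x) cp.
have up' : unit_valued (fun z => p (z + (y - x))) by move=> t; exact: up.
apply: (response_le cp' up' H (is_response_shift (y - x) H)) => t.
by apply: pnd; rewrite lerDl subr_ge0.
Qed.

(** If a2 <> 0 then h2 is differentiable with h2' >= 0, so it is a sub-solution at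
    relative velocity a1 <= a2.  If a2 = 0 then h2 has no derivative to work
    with, and the sign of h1' is used instead. *)
Lemma response_nonincreasing_velocity a1 a2 p h1 h2 : continuous p ->
  unit_valued p -> {homo p : x y / x <= y} ->
  is_response a1 p h1 -> is_response a2 p h2 ->
  a1 <= a2 -> forall z, h2 z <= h1 z.
Proof.
move=> cp up pnd H1 H2 a12 z.
have nd1 := response_nondecreasing cp up pnd H1.
have nd2 := response_nondecreasing cp up pnd H2.
have [e|a20] := eqVneq a2 0.
  have [e1|a10] := eqVneq a1 0.
    by move: H2; rewrite e -e1 => H2; rewrite (response_unique cp up H1 H2).
  have [_ [d1 /(_ a10) hd1 e1]] := H1 z.
  have [_ [d2 _ e2]] := H2 z.
  have d10 := ge0_of_derive_nondecreasing nd1 hd1.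
  have kz := rate_ge1 up z.
  rewrite -(@ler_pM2l _ (rate p z)); last exact: lt_le_trans kz.
  have : a1 * d1 <= 0 by rewrite mulr_le0_ge0// -e.
  move: e2; rewrite e mul0r; lra.
apply: (@sub_response_le a1 p h2 h1 1) => //.
  by move=> y; case/andP: (H2 y).1.
move=> y; have [_ [d /(_ a20) hd e]] := H2 y; exists d => //.
have d0 := ge0_of_derive_nondecreasing nd2 hd.
have : a1 * d <= a2 * d by rewrite ler_wpM2r.
lra.
Qed.

(** The influence of p at distance more than A is exponentially small, since
    information travels at relative speed at most L while being damped at rate
    at least 1. *)
Lemma response_local a L p1 p2 h1 h2 e A z : `|a| <= L -> 0 < L ->
  0 <= A -> 0 <= e ->
  continuous p1 -> unit_valued p1 -> continuous p2 -> unit_valued p2 ->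
  is_response a p1 h1 -> is_response a p2 h2 ->
  (forall y, `|y - z| <= A -> `|p1 y - p2 y| <= e) ->
  `|h1 z - h2 z| <= (1 + r) * e + expR (- (A / L)).
Proof.
move=> aL L0 A0 e0.
wlog suff W : p1 p2 h1 h2 / continuous p1 -> unit_valued p1 -> continuous p2 -> unit_valued p2 ->
  is_response a p1 h1 -> is_response a p2 h2 ->
  (forall y, `|y - z| <= A -> `|p1 y - p2 y| <= e) ->
  h1 z - h2 z <= (1 + r) * e + expR (- (A / L)).
  move=> c1 u1 c2 u2 H1 H2 H; rewrite ler_norml lerNl opprB.
  apply/andP; split; [apply: (W p2 p1) => //|exact: (W p1 p2)].
  by move=> y /H; rewrite distrC.
move=> c1 u1 c2 u2 H1 H2 H.
rewrite -[expR _]mul1r.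
have s0 : 0 <= (1 + r) * e by rewrite mulr_ge0// addr_ge0// ltW.
apply: (@max_principle_local R a ((1 + r) * e) 1 A L (rate p1) (fun z => h1 z - h2 z)) => //.
- exact: rate_continuous.
- exact: rate_ge1.
- move=> y /H ye.
  have [_ [d1 hd1 e1]] := H1 y; have [/andP[h20 h21] [d2 hd2 e2]] := H2 y.
  exists (d1 - d2); first by move=> a0; exact: derB (hd1 a0) (hd2 a0).
  have -> : a * (d1 - d2) + rate p1 y * (h1 y - h2 y)
     = (p1 y - p2 y) * (1 + r * h2 y).
    by move: e1 e2; rewrite /rate; lra.
  have rh : 0 <= 1 + r * h2 y <= 1 + r.
    rewrite addr_ge0//= ?mulr_ge0 ?(ltW r_gt0)//.
    by rewrite lerD2l ler_piMr// ltW.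
  case/andP: rh => rh0 rh1.
  apply: (@le_trans _ _ (e * (1 + r * h2 y))).
    by rewrite ler_wpM2r// (le_trans _ ye)// ler_norm.
  by rewrite mulrC ler_wpM2r.
- move=> y; have /andP[_ ?] := (H1 y).1; have /andP[? _] := (H2 y).1; lra.
Qed.

Lemma response_cst a l : 0 <= l <= 1 ->
  is_response a (fun=> l) (fun=> l / (1 + r - r * l)).
Proof.
move=> /andP[l0 l1] z.
have kz : 0 < 1 + r - r * l.
  have : r * l <= r * 1 by rewrite ler_wpM2l// ltW.
  lra.
split.
  rewrite divr_ge0 ?(ltW kz)//= ler_pdivrMr// mul1r.
  have : r * l <= r * 1 by rewrite ler_wpM2l// ltW.
  lra.
exists 0; first by move=> _; exact: der_cst.
by rewrite mulr0 add0r /rate mulrC divfK// gt_eqF.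
Qed.

Lemma response_slope a p h (z d : R) : unit_valued p -> is_response a p h ->
  a * d + rate p z * h z = p z -> `|a * d| <= 1 + r.
Proof.
move=> up H e; have [/andP[h0 h1] _] := H z.
have /andP[k0 k1] := rate_bounds z up; have /andP[p0 p1] := up z.
have kh0 : 0 <= rate p z * h z by rewrite mulr_ge0.
have kh1 : rate p z * h z <= (1 + r) * 1 by rewrite ler_pM.
by rewrite ler_norml; apply/andP; have := r_gt0; split; lra.
Qed.

Lemma response_lipschitz a p h x y : unit_valued p -> is_response a p h ->
  `|a| * `|h x - h y| <= (1 + r) * `|x - y|.
Proof.
move=> up H.
have [->|a0] := eqVneq a 0.
  by rewrite normr0 mul0r mulr_ge0// addr_ge0// ltW.
rewrite mulrC -ler_pdivlMr ?normr_gt0// mulrAC.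
apply: lipschitz_of_derive => t.
have [_ [d /(_ a0) hd e]] := H t; exists d => //.
by rewrite ler_pdivlMr ?normr_gt0// -normrM mulrC (response_slope up H e).
Qed.

(** The difference solves the equation at velocity a1 with source
    (a2 - a1) h2', and |a2 h2'| <= 1 + r. *)
Lemma response_velocity_lipschitz a1 a2 p h1 h2 z : continuous p -> unit_valued p ->
  is_response a1 p h1 -> is_response a2 p h2 ->
  `|a2| * `|h1 z - h2 z| <= (1 + r) * `|a1 - a2|.
Proof.
move=> cp up H1 H2.
have [->|a0] := eqVneq a2 0.
  by rewrite normr0 mul0r mulr_ge0// addr_ge0// ltW.
rewrite mulrC -ler_pdivlMr ?normr_gt0//.
apply: (@max_principle_abs R a1 _ 2 (rate p) (fun z => h1 z - h2 z)) => //.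
- exact: rate_continuous.
- exact: rate_ge1.
- move=> y; have [_ [d1 hd1 e1]] := H1 y; have [_ [d2 /(_ a0) hd2 e2]] := H2 y.
  exists (d1 - d2); first by move=> a10; exact: derB (hd1 a10) hd2.
  have -> : a1 * (d1 - d2) + rate p y * (h1 y - h2 y) = (a2 - a1) * d2 by lra.
  rewrite normrM ler_pdivlMr ?normr_gt0// (distrC a2) -mulrA -normrM.
  by rewrite mulrC ler_wpM2r// mulrC (response_slope up H2 e2).
- move=> y; have /andP[? ?] := (H1 y).1; have /andP[? ?] := (H2 y).1.
  by rewrite ler_norml; apply/andP; split; lra.
Qed.

(** The barrier 1 - g exp (- l z) with g = (1 + r) / (1 - l a) solves the equation
    linearized at p = 1 exactly; the quadratic term has the good sign where
    z >= 0, and for z <= 0, where p = 0, the barrier is a sub-solution because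
    exp (- l z) >= 1. *)
Lemma exponential_sub_response a l p h : 0 < l -> l * a < 1 ->
  (forall z, p z = Num.max 0 (1 - expR (- (l * z)))) ->
  continuous p -> unit_valued p -> is_response a p h ->
  forall z, 1 - (1 + r) / (1 - l * a) * expR (- (l * z)) <= h z.
Proof.
move=> l0 la pE cp up H z.
have la0 : 0 < 1 - l * a by rewrite subr_gt0.
have cE : (1 + r) / (1 - l * a) * (1 - l * a) = 1 + r by rewrite divfK// gt_eqF.
have : 0 < (1 + r) / (1 - l * a) by rewrite divr_gt0// addr_gt0.
move: ((1 + r) / (1 - l * a)) cE => c cE c0.
apply: (@sub_response_le a p (fun z => 1 - c * expR (- (l * z))) h 1) => //.
  by move=> y; rewrite gerBl mulr_ge0// ?expR_ge0// (ltW c0).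
move=> y; set E := expR (- (l * y)).
exists (c * E * l).
  move=> _.
  apply: (is_derive_eq (derB (der_cst 1 y) (derMl c (der_expR (derN (derMl l (der_id y))))))).
  by rewrite -/E; ring.
have E0 : 0 < E by exact: expR_gt0.
rewrite /rate pE -/E.
have [h1|h1] := leP 0 (1 - E).
  have : 0 <= r * c * (E * E) by apply/ltW; rewrite !mulr_gt0.
  have : E * (c * (1 - l * a)) = E * (1 + r) by rewrite cE.
  lra.
have h2 : 0 <= (E - 1) * (1 + r)
  by apply: mulr_ge0; [rewrite subr_ge0 ltW// -subr_lt0|rewrite addr_ge0// ltW].
have h3 : c * E * (1 + r - a * l) >= E * (1 + r).
  have -> : c * E * (1 + r - a * l) = E * (c * (1 - l * a)) + c * E * r by ring.
  by rewrite cE lerDl; apply/ltW; rewrite !mulr_gt0.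
lra.
Qed.

End Response.

(** * The weight 1 / sqrt |x - c| *)

Section SingularWeight.
Context {R : realType}.
Notation mu := (@lebesgue_measure R).
Implicit Types (f F : R -> R) (a b c x : R).

Lemma measurable_off_point f c :
  (forall x, x != c -> {for x, continuous f}) -> measurable_fun setT f.
Proof.
move=> cf.
have -> : [set: R] = [set c] `|` ~` [set c] by rewrite setUv.
have mc : measurable [set c] by exact: measurable_set1.
apply/measurable_funU => //; first exact: measurableC.
split; first exact: measurable_fun_set1.
apply: open_continuous_measurable_fun.
  by apply: closed_openC; exact: closed_eq.
by move=> x; rewrite inE/= => /eqP; exact: cf.
Qed.

Lemma integral_of_derivative f F a b : a < b ->
  (forall x, a <= x <= b -> is_derive x 1 F (f x)) ->
  (forall x, a <= x <= b -> {for x, continuous f}) ->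
  (\int[mu]_(x in `[a, b]) (f x)%:E = (F b - F a)%:E)%E.
Proof.
move=> ab dF cf; rewrite EFinB; apply: continuous_FTC2 => //.
- by apply: continuous_in_subspaceT => x; rewrite inE/= in_itv/=; exact: cf.
- have cF x : a <= x <= b -> {for x, continuous F}.
    by move=> /dF; exact: is_derive_continuous.
  split.
  + by move=> x; rewrite in_itv/= => /andP[/ltW xa /ltW xb]; case: (dF x); rewrite ?xa.
  + by apply: cvg_at_right_filter; apply: cF; rewrite lexx ltW.
  + by apply: cvg_at_left_filter; apply: cF; rewrite lexx andbT ltW.
- move=> x; rewrite in_itv/= => /andP[/ltW xa /ltW xb].
  by rewrite derive1E; apply: derive_val; apply: dF; rewrite xa.
Qed.

Definition inv_sqrt c x : R := (Num.sqrt `|x - c|)^-1.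

Lemma inv_sqrt_ge0 c x : 0 <= inv_sqrt c x.
Proof. by rewrite invr_ge0 sqrtr_ge0. Qed.

Lemma inv_sqrt_sqr c x : x != c -> `|x - c| * inv_sqrt c x = Num.sqrt `|x - c|.
Proof.
move=> xc; have h : 0 < `|x - c| by rewrite normr_gt0 subr_eq0.
rewrite /inv_sqrt -[X in X / _](@sqr_sqrtr _ `|x - c|)// expr2 mulfK//.
by rewrite gt_eqF// sqrtr_gt0.
Qed.

Lemma inv_sqrt_continuous c x : x != c -> {for x, continuous (inv_sqrt c)}.
Proof.
move=> xc; apply: cvgV.
  by rewrite gt_eqF// sqrtr_gt0 normr_gt0 subr_eq0.
apply: continuous_cvg; first exact: sqrt_continuous.
apply: cvg_norm; apply: cvgB; [exact: cvg_id|exact: cvg_cst].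
Qed.

Lemma measurable_inv_sqrt c : measurable_fun setT (inv_sqrt c).
Proof. by apply: measurable_off_point => x; exact: inv_sqrt_continuous. Qed.

Lemma integral_inv_sqrt_right c (e : R) : 0 < e < 1 ->
  (\int[mu]_(x in `[(c + e)%R, (c + 1)%R]) (inv_sqrt c x)%:E <= 2%:E)%E.
Proof.
move=> /andP[e0 e1].
pose F := (fun x => 2 * Num.sqrt (x - c)).
rewrite [X in (X <= _)%E](_ : _ = (F (c + 1) - F (c + e))%:E).
  rewrite lee_fin /F [c + 1]addrC addrK sqrtr1 [c + e]addrC addrK.
    by rewrite mulr1 gerBl mulr_ge0 ?sqrtr_ge0.
apply: integral_of_derivative => //.
- by rewrite ltrD2l.
- move=> x /andP[cx _]; have xc : 0 < x - c by lra.
  apply: (is_derive_eq (derMl 2 (@der_comp R Num.sqrt _ x _ _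
    (is_derive1_sqrt xc) (derBc c (der_id x))))).
  by rewrite /inv_sqrt gtr0_norm// mulr1 invfM mulrA divff// mul1r.
- by move=> x /andP[cx _]; apply: inv_sqrt_continuous; rewrite gt_eqF//; lra.
Qed.

Lemma integral_inv_sqrt_left c (e : R) : 0 < e < 1 ->
  (\int[mu]_(x in `[(c - 1)%R, (c - e)%R]) (inv_sqrt c x)%:E <= 2%:E)%E.
Proof.
move=> /andP[e0 e1].
pose F := (fun x => - (2 * Num.sqrt (c - x))).
rewrite [X in (X <= _)%E](_ : _ = (F (c - e) - F (c - 1))%:E).
  rewrite lee_fin /F !opprB !(addrC c) !subrK sqrtr1.
    by rewrite mulr1 opprK addrC gerBl mulr_ge0 ?sqrtr_ge0.
apply: integral_of_derivative => //.
- by rewrite ltrD2l ltrN2.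
- move=> x /andP[_ cx]; have xc : 0 < c - x by lra.
  apply: (is_derive_eq (derN (derMl 2 (@der_comp R Num.sqrt _ x _ _
    (is_derive1_sqrt xc) (derB (der_cst c x) (der_id x)))))).
  rewrite /inv_sqrt distrC gtr0_norm// sub0r mulrN1 mulrN opprK.
  by rewrite invfM mulrA divff// mul1r.
- by move=> x /andP[_ cx]; apply: inv_sqrt_continuous; rewrite lt_eqF//; lra.
Qed.

(** The singularity is exhausted by removing |x - c| < 1 / (n + 2). *)
Lemma integral_inv_sqrt c : (\int[mu]_(x in `[(c - 1)%R, (c + 1)%R]) (inv_sqrt c x)%:E <= 4%:E)%E.
Proof.
have mE : forall D, measurable_fun D (fun x => (inv_sqrt c x)%:E).
  by move=> D; apply/measurable_EFinP; apply: measurable_funTS; exact: measurable_inv_sqrt.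
rewrite -(@integral_setD1 _ _ c); last 2 first.
- exact: measurableD.
- exact: mE.
pose e n : R := n.+2%:R^-1.
have eP n : 0 < e n < 1.
  by rewrite /e invr_gt0 ltr0n/= invf_lt1 ?ltr0n// ltr1n.
pose F n := `[c - 1, c - e n] `|` `[c + e n, c + 1] : set R.
have FE : `[c - 1, c + 1] `\ c = \bigcup_n F n.
  apply/seteqP; split => [x [/=]|x [n _ /=]].
    rewrite in_itv/= => /andP[h1 h2] /eqP xc.
    have h0 : 0 < `|x - c| by rewrite normr_gt0 subr_eq0.
    have [n en] : exists n, e n <= `|x - c|.
      exists (Num.trunc `|x - c|^-1).
      rewrite /e -[leRHS]invrK lef_pV2 ?posrE ?invr_gt0//.
      apply/ltW/(lt_le_trans (truncnS_gt _)).
      by rewrite ler_nat.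
    exists n => //; rewrite /F/= !in_itv/= h1 h2 andbT/=.
    have [xc'|xc'] := leP x c.
      by left; move: en; rewrite ler0_norm ?subr_le0//; lra.
    by right; move: en; rewrite gtr0_norm ?subr_gt0//; lra.
  have /andP[h1 h2] := eP n.
  rewrite /F/= !in_itv/= => -[] /andP[h3 h4]; split.
  - by apply/andP; split; lra.
  - by apply/eqP; rewrite lt_eqF//; lra.
  - by apply/andP; split; lra.
  - by apply/eqP; rewrite gt_eqF//; lra.
rewrite FE.
have mF n : measurable (F n) by exact: measurableU.
have ndF : nondecreasing_seq F.
  move=> m n mn; apply/subsetPset => x /=; rewrite /F/= !in_itv/=.
  have : e n <= e m by rewrite /e lef_pV2 ?posrE ?ltr0n// ler_nat.
  by move=> ? -[] /andP[h3 h4]; [left|right]; apply/andP; split; lra.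
have H : (\int[mu]_(x in F i) (inv_sqrt c x)%:E @[i --> \oo] -->
    \int[mu]_(x in \bigcup_i F i) (inv_sqrt c x)%:E)%E.
  apply: ge0_nondecreasing_set_cvg_integral => //.
  - by move=> i; exact: mE.
  - by move=> i x _; rewrite lee_fin; exact: inv_sqrt_ge0.
apply: (cvge_le _ H).
apply: nearW => n.
have /andP[h1 h2] := eP n.
rewrite ge0_integral_setU//=; last 3 first.
- exact: mE.
- by move=> *; rewrite lee_fin inv_sqrt_ge0.
- apply/disj_setPS => x [/=]; rewrite !in_itv/=; lra.
have -> : 4%:E = (2%:E + 2%:E)%E :> \bar R by rewrite -EFinD; congr EFin; lra.
by apply: leeD; [exact: integral_inv_sqrt_left|exact: integral_inv_sqrt_right].
Qed.

Definition inv_sqrt_near c : R -> R := inv_sqrt c \_ `[c - 1, c + 1].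

Lemma integrable_inv_sqrt_near c D : measurable D -> mu.-integrable D (EFin \o inv_sqrt_near c).
Proof.
move=> mD; apply: (@integrableS _ _ _ _ setT) => //.
have -> : EFin \o inv_sqrt_near c = (EFin \o inv_sqrt c) \_ `[c - 1, c + 1].
  by rewrite /inv_sqrt_near -restrict_EFin.
apply/(integrable_mkcond _ _).1 => //.
apply/integrableP; split.
  by apply/measurable_EFinP; apply: measurable_funTS; exact: measurable_inv_sqrt.
under eq_integral do rewrite /= ger0_norm ?inv_sqrt_ge0//.
by apply: (le_lt_trans (integral_inv_sqrt c)); rewrite ltry.
Qed.

Lemma inv_sqrt_near_ge0 c x : 0 <= inv_sqrt_near c x.
Proof. by rewrite /inv_sqrt_near patchE; case: ifP => // _; exact: inv_sqrt_ge0. Qed.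

Lemma inv_sqrt_le_inv_sqrt_near c x : inv_sqrt c x <= inv_sqrt_near c x + 1.
Proof.
rewrite /inv_sqrt_near patchE; case: ifPn; first by rewrite lerDl.
rewrite notin_setE/= in_itv/= add0r => h.
have h1 : 1 <= `|x - c|.
  rewrite leNgt; apply/negP => /ltr_normlP[h1 h2]; apply: h.
  by apply/andP; split; lra.
rewrite /inv_sqrt invf_le1; first by rewrite -sqrtr1 ler_sqrt.
by rewrite sqrtr_gt0 (lt_le_trans _ h1).
Qed.

Lemma Rintegral_inv_sqrt_near c D : measurable D -> \int[mu]_(x in D) inv_sqrt_near c x <= 4.
Proof.
move=> mD.
have h : (\int[mu]_(x in D) (inv_sqrt_near c x)%:E <= 4%:E)%E.
  apply: (@le_trans _ _ (\int[mu]_x (inv_sqrt_near c x)%:E)%E).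
    apply: ge0_subset_integral => //.
      by apply/measurable_EFinP; apply: (measurable_restrictT _ _).1 => //;
        apply: measurable_funTS; exact: measurable_inv_sqrt.
    by move=> x _; rewrite lee_fin inv_sqrt_near_ge0.
  apply: le_trans (integral_inv_sqrt c).
  rewrite [leRHS]integral_mkcond.
  rewrite le_eqVlt; apply/orP; left; apply/eqP/eq_integral => x _.
  by rewrite /inv_sqrt_near !patchE; case: ifP.
rewrite /Rintegral -[leRHS]/(fine 4%:E) fine_le//.
by have /integrable_fin_num := integrable_inv_sqrt_near c mD; exact.
Qed.

End SingularWeight.

Record velocity_density (R : realType) (V : set R) (M : R -> R) : Prop :=
  VelocityDensity {
    density_compact : compact V;
    density_continuous : {within V, continuous M};
    density_ge0 : forall v : R, V v -> 0 <= M v;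
    density_mass : (\int[@lebesgue_measure R]_(v in V) (M v)%:E = 1%:E)%E }.

(** * Averages over the velocities *)

Section Average.
Context {R : realType}.
Notation mu := (@lebesgue_measure R).
Variables (V : set R) (M : R -> R).

Definition avg_integrable (g : R -> R) := mu.-integrable V (EFin \o (fun v => M v * g v)).

Definition avg (g : R -> R) : R := \int[mu]_(v in V) (M v * g v).

Hypothesis VM : velocity_density V M.
Let V_compact := density_compact VM.
Let M_cont := density_continuous VM.
Let M_ge0 := density_ge0 VM.
Let M_mass := density_mass VM.
Implicit Types (g w : R -> R) (c v : R).

Let mV : measurable V := compact_measurable V_compact.

Lemma M_measurable : measurable_fun V M.
Proof. by apply: subspace_continuous_measurable_fun. Qed.

Lemma M_integrable : mu.-integrable V (EFin \o M).
Proof. exact: continuous_compact_integrable. Qed.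

Lemma M_bounded : exists2 m, 0 < m & forall v, V v -> M v <= m.
Proof.
have /compact_bounded[m0 [_ Hm]] := continuous_compact M_cont V_compact.
exists (`|m0| + 1) => [|v Vv]; first by rewrite ltr_wpDl.
apply: (le_trans (ler_norm _)).
by apply: Hm; [rewrite ltr_pwDr// ler_norm|exists v].
Qed.

Lemma velocities_bounded : exists2 W, 0 < W & forall v, V v -> `|v| <= W.
Proof.
have /compact_bounded[m0 [_ Hm]] := V_compact.
exists (`|m0| + 1) => [|v Vv]; first by rewrite ltr_wpDl.
by apply: Hm; [rewrite ltr_pwDr// ler_norm|].
Qed.

Lemma avg_integrable_bounded g (B : R) : measurable_fun V g ->
  (forall v, V v -> `|g v| <= B) -> avg_integrable g.
Proof.
move=> mg gB.
apply: (@le_integrable _ _ _ mu V mV _ (fun v => (B * M v)%:E)).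
- by apply/measurable_EFinP; apply: measurable_funM => //; exact: M_measurable.
- move=> v Vv /=; rewrite lee_fin !normrM mulrC ler_wpM2r//.
  by rewrite (le_trans (gB v Vv))// ler_norm.
- have -> : (fun v => (B * M v)%:E) = (fun v => B%:E * (EFin \o M) v)%E.
    by apply/funext => v; rewrite EFinM.
  by apply: integrableZl => //; exact: M_integrable.
Qed.

Lemma avg_integrable_cst b : avg_integrable (fun=> b).
Proof. by apply: (@avg_integrable_bounded _ `|b|). Qed.

Lemma avg_integrable_inv_sqrt c : avg_integrable (inv_sqrt c).
Proof.
have [m m0 mM] := M_bounded.
have h1 : mu.-integrable V (fun v => (m * inv_sqrt_near c v)%:E + (M v)%:E)%E.
  apply: integrableD => //; last exact: M_integrable.
  have -> : (fun v => (m * inv_sqrt_near c v)%:E) = (fun v => m%:E * (EFin \o inv_sqrt_near c) v)%E.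
    by apply/funext => v; rewrite EFinM.
  by apply: integrableZl => //; exact: integrable_inv_sqrt_near.
apply: (@le_integrable _ _ _ mu V mV _ _ _ _ h1).
- apply/measurable_EFinP; apply: measurable_funM; first exact: M_measurable.
  by apply: measurable_funTS; exact: measurable_inv_sqrt.
- move=> v Vv /=; rewrite lee_fin.
  have MV := M_ge0 Vv.
  rewrite !ger0_norm ?mulr_ge0 ?addr_ge0 ?mulr_ge0 ?inv_sqrt_ge0 ?inv_sqrt_near_ge0 ?(ltW m0)//.
  apply: (le_trans (ler_wpM2l MV (inv_sqrt_le_inv_sqrt_near c v))).
  by rewrite mulrDr mulr1 lerD2r ler_wpM2r ?inv_sqrt_near_ge0// mM.
Qed.

Lemma avg_inv_sqrt : exists2 A, 0 < A & forall c, avg (inv_sqrt c) <= A.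
Proof.
have [m m0 mM] := M_bounded.
exists (m * 4 + 1) => [|c]; first by rewrite ltr_wpDl// mulr_ge0// ltW.
have i1 : mu.-integrable V (EFin \o (fun v => m * inv_sqrt_near c v)).
  have -> : EFin \o (fun v => (m * inv_sqrt_near c v)) = (fun v => m%:E * (EFin \o inv_sqrt_near c) v)%E.
    by apply/funext => v; rewrite /= EFinM.
  by apply: integrableZl => //; exact: integrable_inv_sqrt_near.
have h1 : mu.-integrable V (EFin \o (fun v => m * inv_sqrt_near c v + M v)).
  have -> : EFin \o (fun v => m * inv_sqrt_near c v + M v) =
    (fun v => ((EFin \o (fun v => m * inv_sqrt_near c v)%R) v + (EFin \o M) v)%E).
    by apply/funext => v; rewrite /= EFinD.
  by apply: integrableD => //; exact: M_integrable.
apply: (@le_trans _ _ (\int[mu]_(v in V) (m * inv_sqrt_near c v + M v))).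
  apply: le_Rintegral => //; first exact: avg_integrable_inv_sqrt.
  move=> v Vv; apply: (le_trans (ler_wpM2l (M_ge0 Vv) (inv_sqrt_le_inv_sqrt_near c v))).
  by rewrite mulrDr mulr1 lerD2r ler_wpM2r ?inv_sqrt_near_ge0// mM.
rewrite RintegralD//; last exact: M_integrable.
rewrite RintegralZl//; last exact: integrable_inv_sqrt_near.
apply: lerD; last by rewrite /Rintegral M_mass.
by rewrite ler_wpM2l ?(ltW m0)//; exact: Rintegral_inv_sqrt_near.
Qed.

Lemma avg_integrableB g1 g2 : avg_integrable g1 -> avg_integrable g2 -> avg_integrable (fun v => g1 v - g2 v).
Proof.
move=> h1 h2; rewrite /avg_integrable.
have -> : EFin \o (fun v => M v * (g1 v - g2 v)) =
   (fun v => ((EFin \o (fun v => M v * g1 v)%R) v - (EFin \o (fun v => M v * g2 v)%R) v)%E).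
  by apply/funext => v; rewrite /= mulrBr EFinB.
exact: integrableB.
Qed.

Lemma avg_integrableZ b g : avg_integrable g -> avg_integrable (fun v => b * g v).
Proof.
move=> h1; rewrite /avg_integrable.
have -> : EFin \o (fun v => M v * (b * g v)) =
   (fun v => (b%:E * (EFin \o (fun v => M v * g v)%R) v)%E).
  by apply/funext => v; rewrite /= mulrCA EFinM.
exact: integrableZl.
Qed.

Lemma avgB g1 g2 : avg_integrable g1 -> avg_integrable g2 ->
  avg (fun v => g1 v - g2 v) = avg g1 - avg g2.
Proof.
move=> h1 h2; rewrite /avg -RintegralB//.
by apply: eq_Rintegral => v _; rewrite mulrBr.
Qed.

Lemma avgZ b g : avg_integrable g -> avg (fun v => b * g v) = b * avg g.
Proof.
move=> h; rewrite /avg -RintegralZl//.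
by apply: eq_Rintegral => v _; rewrite mulrCA.
Qed.

Lemma avg_cst b : avg (fun=> b) = b.
Proof.
rewrite /avg; under eq_Rintegral do rewrite mulrC.
by rewrite RintegralZl ?M_integrable// /Rintegral M_mass mulr1.
Qed.

Lemma avg_setD1 c g : avg_integrable g -> avg g = \int[mu]_(v in V `\ c) (M v * g v).
Proof.
move=> h; rewrite /avg /Rintegral (@integral_setD1 _ _ c)//.
  exact: measurableD.
by move/integrableP : h => [h _]; apply: measurable_funS h => //; exact: subDsetl.
Qed.

(** The inequality may fail at one velocity: the estimates for the transport
    equation degenerate at v = c. *)
Lemma avg_le c g1 g2 : avg_integrable g1 -> avg_integrable g2 ->
  (forall v, V v -> v != c -> g1 v <= g2 v) -> avg g1 <= avg g2.
Proof.
move=> h1 h2 g12; rewrite (avg_setD1 c h1) (avg_setD1 c h2).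
have mVc : measurable (V `\ c) by exact: measurableD.
have sVc : V `\ c `<=` V by exact: subDsetl.
apply: le_Rintegral => //; [exact: integrableS h1|exact: integrableS h2|].
by move=> v /= [Vv /eqP vc]; rewrite ler_wpM2l ?M_ge0// g12.
Qed.

Lemma avg_eq c g1 g2 : avg_integrable g1 -> avg_integrable g2 ->
  (forall v, V v -> v != c -> g1 v = g2 v) -> avg g1 = avg g2.
Proof.
by move=> h1 h2 g12; apply/le_anti/andP; split; apply: (@avg_le c) => // v Vv vc;
  rewrite g12.
Qed.

Lemma avg_norm_le c g1 g2 w : avg_integrable g1 -> avg_integrable g2 -> avg_integrable w ->
  (forall v, V v -> v != c -> `|g1 v - g2 v| <= w v) ->
  `|avg g1 - avg g2| <= avg w.
Proof.
move=> h1 h2 hw H.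
have hN : avg_integrable (fun v => -1 * w v) by exact: avg_integrableZ.
rewrite -avgB// ler_norml -mulN1r -avgZ//.
apply/andP; split; apply: (@avg_le c) => //; try exact: avg_integrableB.
- by move=> v Vv vc; move: (H v Vv vc); rewrite ler_norml mulN1r => /andP[].
- by move=> v Vv vc; move: (H v Vv vc); rewrite ler_norml => /andP[].
Qed.

(** Velocities with M v = 0 carry no weight, and 1 - f / M satisfies its equation
    only where M > 0. *)
Lemma avg_le_pos g1 g2 : avg_integrable g1 -> avg_integrable g2 ->
  (forall v, V v -> 0 < M v -> g1 v <= g2 v) -> avg g1 <= avg g2.
Proof.
move=> h1 h2 g12; apply: le_Rintegral => // v Vv.
have := M_ge0 Vv; rewrite le_eqVlt => /predU1P[<-|Mv]; first by rewrite !mul0r.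
by rewrite ler_wpM2l ?(ltW Mv)// g12.
Qed.

(** The constant A does not depend on c, which is used when the speed varies. *)
Lemma avg_dist_inv_sqrt : exists2 A, 0 < A & forall c (K : R) g1 g2, 0 <= K ->
  avg_integrable g1 -> avg_integrable g2 ->
  (forall v, V v -> v != c -> `|g1 v - g2 v| <= K * inv_sqrt c v) ->
  `|avg g1 - avg g2| <= K * A.
Proof.
have [A A0 HA] := avg_inv_sqrt; exists A => // c K g1 g2 K0 h1 h2 H.
have ws := avg_integrable_inv_sqrt c.
apply: (le_trans (avg_norm_le h1 h2 (avg_integrableZ K ws) H)).
by rewrite avgZ// ler_wpM2l.
Qed.

Lemma avg_cvg (g : nat -> R -> R) (l : R -> R) (B : R) :
  (forall n, avg_integrable (g n)) -> avg_integrable l ->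
  (forall n v, V v -> `|g n v| <= B) ->
  (forall v, V v -> 0 < M v -> g n v @[n --> \oo] --> l v) ->
  avg (g n) @[n --> \oo] --> avg l.
Proof.
move=> wg wl gB gl; apply: fine_cvg.
rewrite /avg /Rintegral fineK; last exact: integrable_fin_num.
have MB : mu.-integrable V (fun v => (B * M v)%:E).
  have -> : (fun v => (B * M v)%:E) = (fun v => B%:E * (EFin \o M) v)%E.
    by apply/funext => v; rewrite EFinM.
  by apply: integrableZl => //; exact: M_integrable.
apply: (@dominated_cvg _ _ _ mu V mV (fun n v => (M v * g n v)%:E) _
  (fun v => (B * M v)%:E)) => //.
- by move=> n; have /integrableP[] := wg n.
- move=> v Vv; apply: cvg_EFin; first exact: nearW.
  have := M_ge0 Vv; rewrite le_eqVlt => /predU1P[e|Mv] /=.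
    have z0 (x : R) : M v * x = 0 by rewrite -e mul0r.
    rewrite z0 (_ : (fun _ => _) = fun=> 0); first exact: cvg_cst.
    by apply/funext => n; rewrite /= z0.
  by apply: cvgM; [exact: cvg_cst|exact: gl].
- move=> n v Vv; rewrite lee_fin normrM ger0_norm ?M_ge0// mulrC.
  by rewrite ler_wpM2r ?M_ge0// gB.
Qed.

Lemma derive_avg (u du : R -> R -> R) (G : R -> R) c :
  (forall z, avg_integrable (u z)) -> (forall z, avg_integrable (du z)) -> avg_integrable G ->
  (forall v, V v -> v != c -> forall z : R, is_derive z 1 (fun y => u y v) (du z v)) ->
  (forall v, V v -> v != c -> forall z, `|du z v| <= G v) ->
  forall z : R, is_derive z 1 (fun y => avg (u y)) (avg (du z)).
Proof.
move=> wu wdu wG dU duG z.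
have mVc : measurable (V `\ c) by exact: measurableD.
have sVc : V `\ c `<=` V by exact: subDsetl.
pose f y v := M v * u y v.
have df (y : R) v : (V `\ c) v -> is_derive y 1 (f ^~ v) (M v * du y v).
  by move=> [Vv /eqP vc]; apply: derMl; exact: dU.
have Iz : `]z - 1, z + 1[%classic z.
  by rewrite /= in_itv/= ltrBlDr ltrDl ltr01.
have pE (y : R) v : (V `\ c) v -> partial1of2 f y v = M v * du y v.
  by move=> /(df y) h; rewrite /partial1of2 derive1E; apply: derive_val.
have H := @cvg_differentiation_under_integral R _ _ mu f (V `\ c) mVc z (z - 1) (z + 1)
  Iz _ _ (fun v => `|M v * G v|) _ _ _.
have {}H : h^-1 *: (\int[mu]_(v in V `\ c) f (h + z) v - \int[mu]_(v in V `\ c) f z v)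
   @[h --> 0^'] --> avg (du z).
  have -> : avg (du z) = \int[mu]_(v in V `\ c) partial1of2 f z v.
    by rewrite (avg_setD1 c (wdu z)); apply: eq_Rintegral => v; rewrite inE => /(pE z) ->.
  apply: H => //.
  - by move=> x _; apply: integrableS (wu x).
  - by move=> x v _ /(df x)[].
  - have -> : EFin \o (fun v => `|M v * G v|) = abse \o (EFin \o (fun v => M v * G v)).
      by apply/funext.
    by apply: integrable_abse; apply: integrableS wG.
  - move=> x v _ Vcv; rewrite pE// !normrM ler_wpM2l//.
    case: Vcv => Vv /eqP vc.
    by apply: (le_trans (duG v Vv vc x)); exact: ler_norm.
have {}H : h^-1 *: ((fun y => avg (u y)) (h *: 1 + z) - (fun y => avg (u y)) z)
   @[h --> 0^'] --> avg (du z).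
  under eq_cvg do rewrite /= (avg_setD1 c (wu _)) (avg_setD1 c (wu z)) [_ *: 1]mulr1.
  exact: H.
by apply: DeriveDef; [apply: cvgP; exact: H|apply: cvg_lim H].
Qed.

End Average.

(** * The front map *)

Section FrontOperator.
Context {R : realType}.
Variables (r : R) (V : set R) (M : R -> R).
Hypothesis r_gt0 : 0 < r.
Hypothesis VM : velocity_density V M.
Implicit Types (a c e l L A B C : R) (p q h g : R -> R) (x y z v : R).

Definition holder C p := forall x y : R, `|p x - p y| <= C * Num.sqrt `|x - y|.

Definition front p :=
  [/\ continuous p, unit_valued p & {homo p : x y / x <= y}].

(** p is to be thought of as 1 - rho for a wave seen in the frame of speed c. *)
Definition front_map c p z : R := avg V M (fun v => response r (v - c) p z).

Lemma sqrtr_le_of_sqr (x s : R) : 0 <= s -> x <= s ^+ 2 -> Num.sqrt x <= s.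
Proof.
move=> s0 xs; have -> : s = Num.sqrt (s ^+ 2) by rewrite sqrtr_sqr ger0_norm.
by rewrite ler_sqrt// sqr_ge0.
Qed.

Lemma le_sqrtr_of_sqr (x s : R) : 0 <= s -> s ^+ 2 <= x -> s <= Num.sqrt x.
Proof.
move=> s0 xs; have -> : s = Num.sqrt (s ^+ 2) by rewrite sqrtr_sqr ger0_norm.
by rewrite ler_sqrt// (le_trans (sqr_ge0 s)).
Qed.

Lemma holder_continuous C p : holder C p -> continuous p.
Proof.
move=> Hp x; apply/cvgrPdist_lt => e e0.
pose C' := `|C| + 1.
have C0 : 0 < C' by rewrite ltr_wpDl.
near=> y.
apply: (le_lt_trans (Hp x y)).
have h : Num.sqrt `|x - y| < e / C'.
  have eC : 0 < e / C' by rewrite divr_gt0.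
  have -> : e / C' = Num.sqrt ((e / C') ^+ 2) by rewrite sqrtr_sqr gtr0_norm.
  rewrite ltr_sqrt ?exprn_gt0//.
  by near: y; apply: cvgr_dist_lt; rewrite ?exprn_gt0 ?divr_gt0.
apply: (@le_lt_trans _ _ (C' * Num.sqrt `|x - y|)).
  by rewrite ler_wpM2r ?sqrtr_ge0// (le_trans (ler_norm C))// lerDl.
by rewrite mulrC -ltr_pdivlMr.
Unshelve. all: end_near. Qed.

Lemma holder_le C C' p : C <= C' -> holder C p -> holder C' p.
Proof.
move=> CC H x y; apply: (le_trans (H x y)).
by rewrite ler_wpM2r ?sqrtr_ge0.
Qed.

(** d is the geometric mean of two bounds: d * d <= N * (b / s). *)
Lemma le_sqrt_interpolation (N d b s : R) : 0 <= d -> 0 <= b -> 0 < s ->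
  d <= N -> s * d <= b -> d <= Num.sqrt (N * b) * (Num.sqrt s)^-1.
Proof.
move=> d0 b0 s0 d1 sd.
rewrite ler_pdivlMr ?sqrtr_gt0//.
apply: le_sqrtr_of_sqr; first by rewrite mulr_ge0 ?sqrtr_ge0.
rewrite exprMn sqr_sqrtr ?(ltW s0)// expr2 -mulrA (mulrC d s).
by apply: ler_pM => //; rewrite mulr_ge0// ltW.
Qed.

Lemma avg_integrable_response c p z : front p -> avg_integrable V M (fun v => response r (v - c) p z).
Proof.
move=> [cp up pnd]; apply: (@avg_integrable_bounded _ _ _ VM _ 1).
  apply: nonincreasing_measurable.
    exact: compact_measurable (density_compact VM).
  move=> v1 v2 v12.
  apply: (response_nonincreasing_velocity r_gt0 cp up pnd (responseP r_gt0 _ cp up)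
    (responseP r_gt0 _ cp up)).
  by rewrite lerD2r.
move=> v _; have [/andP[h0 h1] _] := responseP r_gt0 (v - c) cp up z.
by rewrite ger0_norm.
Qed.

Lemma avg_unit g : avg_integrable V M g -> (forall v, V v -> 0 <= g v <= 1) ->
  0 <= avg V M g <= 1.
Proof.
move=> gi g01; apply/andP; split.
  rewrite -[leLHS](avg_cst VM); apply: (@avg_le _ _ _ VM 0) => //.
    exact: avg_integrable_cst.
  by move=> v /g01/andP[].
rewrite -[leRHS](avg_cst VM); apply: (@avg_le _ _ _ VM 0) => //.
  exact: avg_integrable_cst.
by move=> v /g01/andP[].
Qed.

Lemma response_dist_unit a1 a2 p h1 h2 x y : is_response r a1 p h1 ->
  is_response r a2 p h2 -> `|h1 x - h2 y| <= 1.
Proof.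
move=> H1 H2; have [/andP[? ?] _] := H1 x; have [/andP[? ?] _] := H2 y.
by rewrite ler_norml; apply/andP; split; lra.
Qed.

(** Responses differ by at most 1, and by at most (1 + r) d / |v - c| for an
    increment d of position or of speed; interpolate and average.  The modulus
    depends neither on the front nor on the speed. *)
Lemma front_map_moduli : exists2 C, 1 <= C & forall c p, front p ->
  holder C (front_map c p) /\
  forall c' z, `|front_map c p z - front_map c' p z| <= C * Num.sqrt `|c - c'|.
Proof.
have [A A0 HA] := avg_dist_inv_sqrt VM.
have b0 : 0 <= 1 + r by rewrite addr_ge0// ltW.
pose C := Num.sqrt (1 + r) * A.
have fin g1 g2 c (d : R) : 0 <= d -> avg_integrable V M g1 -> avg_integrable V M g2 ->
    (forall v, V v -> v != c -> `|g1 v - g2 v| <= Num.sqrt ((1 + r) * d) * inv_sqrt c v) ->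
    `|avg V M g1 - avg V M g2| <= Num.max 1 C * Num.sqrt d.
  move=> d0 i1 i2 /(HA _ _ _ _ (sqrtr_ge0 _) i1 i2)/le_trans; apply.
  rewrite sqrtrM// mulrAC.
  by rewrite ler_wpM2r ?sqrtr_ge0// le_max lexx orbT.
exists (Num.max 1 C); first by rewrite le_max lexx.
move=> c p fp; have [cp up pnd] := fp; split.
- move=> x y; apply: (fin _ _ c) => //; try exact: avg_integrable_response.
  move=> v Vv vc.
  have H := responseP r_gt0 (v - c) cp up.
  rewrite -[(1 + r) * _]mul1r; apply: le_sqrt_interpolation => //.
  + by rewrite mulr_ge0.
  + by rewrite normr_gt0 subr_eq0.
  + exact (response_dist_unit x y H H).
  + exact (response_lipschitz r_gt0 x y up H).
- move=> c' z; apply: (fin _ _ c') => //; try exact: avg_integrable_response.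
  move=> v Vv vc.
  have H := responseP r_gt0 (v - c) cp up.
  have H' := responseP r_gt0 (v - c') cp up.
  rewrite -[(1 + r) * _]mul1r; apply: le_sqrt_interpolation => //.
  + by rewrite mulr_ge0.
  + by rewrite normr_gt0 subr_eq0.
  + exact (response_dist_unit z z H H').
  + apply: (le_trans (response_velocity_lipschitz r_gt0 z cp up H H')).
    have -> : v - c - (v - c') = c' - c by ring.
    by rewrite distrC.
Qed.

Lemma front_map_front c p : front p -> front (front_map c p).
Proof.
move=> fp; have [cp up pnd] := fp.
have [C _ HC] := front_map_moduli.
split.
- exact: holder_continuous (HC c p fp).1.
- move=> z; apply: avg_unit; first exact: avg_integrable_response.
  by move=> v _; case: (responseP r_gt0 (v - c) cp up z).
- move=> x y xy; apply: (@avg_le _ _ _ VM 0); try exact: avg_integrable_response.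
  move=> v Vv _.
  exact (response_nondecreasing r_gt0 cp up pnd (responseP r_gt0 (v - c) cp up) xy).
Qed.

Lemma front_map_le c p q : front p -> front q -> (forall y, p y <= q y) ->
  forall z, front_map c p z <= front_map c q z.
Proof.
move=> fp fq pq z; have [cp up _] := fp; have [cq uq _] := fq.
apply: (@avg_le _ _ _ VM 0); try exact: avg_integrable_response.
move=> v Vv _.
exact (response_le r_gt0 cq uq (responseP r_gt0 (v - c) cp up) (responseP r_gt0 (v - c) cq uq) pq z).
Qed.

Lemma front_map_shift c p t z : front p ->
  front_map c (fun z => p (z + t)) z = front_map c p (z + t).
Proof.
move=> [cp up _]; rewrite /front_map; congr avg; apply/funext => v.
exact: response_shift.
Qed.

Lemma front_shift p t : front p -> front (fun z => p (z + t)).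
Proof.
move=> [cp up pnd]; split; first exact: continuous_shift.
- by move=> z; exact: up.
- by move=> x y xy; apply: pnd; rewrite lerD2r.
Qed.

Lemma front_map_speed_le c1 c2 p z : front p -> c1 <= c2 ->
  front_map c1 p z <= front_map c2 p z.
Proof.
move=> fp c12; have [cp up pnd] := fp.
apply: (@avg_le _ _ _ VM 0); try exact: avg_integrable_response.
move=> v Vv _.
apply: (response_nonincreasing_velocity r_gt0 cp up pnd (responseP r_gt0 _ cp up)
    (responseP r_gt0 _ cp up)).
by rewrite lerD2l lerN2.
Qed.

Lemma front_map_local c L A e p q z : (forall v, V v -> `|v - c| <= L) -> 0 < L ->
  0 <= A -> 0 <= e -> front p -> front q ->
  (forall y, `|y - z| <= A -> `|p y - q y| <= e) ->
  `|front_map c p z - front_map c q z| <= (1 + r) * e + expR (- (A / L)).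
Proof.
move=> VL L0 A0 e0 fp fq pq; have [cp up _] := fp; have [cq uq _] := fq.
rewrite -[leRHS](avg_cst VM).
apply: (@avg_norm_le _ _ _ VM 0); try exact: avg_integrable_response; first exact: avg_integrable_cst.
move=> v Vv _.
exact (response_local r_gt0 (VL v Vv) L0 A0 e0 cp up cq uq (responseP r_gt0 _ cp up)
  (responseP r_gt0 _ cq uq) pq).
Qed.

Definition const_response l : R := l / (1 + r - r * l).

Lemma front_cst l : 0 <= l <= 1 -> front (fun=> l).
Proof. by move=> l01; split=> // x; exact: cvg_cst. Qed.

Lemma front_map_cst c l z : 0 <= l <= 1 -> front_map c (fun=> l) z = const_response l.
Proof.
move=> l01; have [cp up _] := front_cst l01.
rewrite /front_map -[RHS](avg_cst VM); congr avg; apply/funext => v.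
by rewrite (response_unique r_gt0 cp up (responseP r_gt0 _ cp up) (response_cst r_gt0 _ l01)).
Qed.

End FrontOperator.

(** * Sub-fronts: limits and approximate waves *)

Section FrontLimits.
Context {R : realType}.
Variables (r : R) (V : set R) (M : R -> R).
Hypothesis r_gt0 : 0 < r.
Hypothesis VM : velocity_density V M.
Implicit Types (a c e l L A B C : R) (p q h g : R -> R) (x y z v : R).
Local Notation T := (front_map r V M).

Lemma velocity_range c : exists2 L, 0 < L & forall v, V v -> `|v - c| <= L.
Proof.
have [W W0 HW] := velocities_bounded VM.
exists (W + `|c|) => [|v /HW vW]; first by rewrite ltr_pwDl.
by rewrite (le_trans (ler_normB _ _))// lerD2r.
Qed.

(** The two filters at infinity have this property: what holds eventually holds
    eventually on balls of any fixed radius. *)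
Definition shiftable (F : set_system R) := forall (A : R) (Q : R -> Prop),
  (\forall z \near F, Q z) -> \forall z \near F, forall y, `|y - z| <= A -> Q y.

Lemma shiftable_ninfty : shiftable -oo.
Proof.
move=> A Q [N [_ HN]]; exists (N - A); split; first exact: num_real.
by move=> z zN y /ler_normlP[_ h]; apply: HN; lra.
Qed.

Lemma shiftable_pinfty : shiftable +oo.
Proof.
move=> A Q [N [_ HN]]; exists (N + A); split; first exact: num_real.
by move=> z zN y /ler_normlP[h _]; apply: HN; lra.
Qed.

(** The hypothesis on g is the conclusion of [response_local] and
    [front_map_local]: choose first A, then the neighbourhood where p is close
    to l. *)
Lemma local_dependence_cvg (F : set_system R) {PF : ProperFilter F} p g l m L :
  0 < L -> shiftable F ->
  (forall A e z, 0 <= A -> 0 <= e -> (forall y, `|y - z| <= A -> `|l - p y| <= e) ->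
    `|m - g z| <= (1 + r) * e + expR (- (A / L))) ->
  p z @[z --> F] --> l -> g z @[z --> F] --> m.
Proof.
move=> L0 sF H pl; apply/cvgrPdist_le => e e0.
have r1 : 0 < 1 + r by rewrite addr_gt0.
pose e' := e / 2 / (1 + r).
have e'0 : 0 < e' by rewrite !divr_gt0.
(* The radius is chosen so that exp (- A / L) < e / 2. *)
pose A := L / (e / 2).
have A0 : 0 <= A by rewrite !divr_ge0// ltW.
have expA : expR (- (A / L)) <= e / 2.
  have -> : A / L = (e / 2)^-1 by rewrite /A mulrAC divff ?gt_eqF// mul1r.
  by rewrite ltW// expRN_inv_lt// divr_gt0.
move/cvgrPdist_le : pl => /(_ _ e'0)/(sF A).
apply: filterS => z Hz; apply: (le_trans (H A e' z A0 (ltW e'0) Hz)).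
by rewrite /e' mulrC divfK ?gt_eqF//; lra.
Qed.

Lemma front_map_cvg (F : set_system R) {PF : ProperFilter F} c p l : shiftable F ->
  front p -> 0 <= l <= 1 ->
  p z @[z --> F] --> l -> T c p z @[z --> F] --> const_response r l.
Proof.
move=> sF fp l01; have [L L0 HL] := velocity_range c.
apply: (local_dependence_cvg L0 sF) => A e z A0 e0 Hz.
rewrite -(front_map_cst r_gt0 VM c z l01).
exact: (front_map_local r_gt0 VM HL L0 A0 e0 (front_cst l01) fp Hz).
Qed.

Lemma response_cvg (F : set_system R) {PF : ProperFilter F} a l p h :
  shiftable F -> front p -> is_response r a p h -> 0 <= l <= 1 ->
  p z @[z --> F] --> l -> h z @[z --> F] --> const_response r l.
Proof.
move=> sF [cp up _] H l01.
have L0 : 0 < `|a| + 1 by rewrite ltr_wpDl.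
have [cl ul _] := front_cst l01.
apply: (local_dependence_cvg L0 sF) => A e z A0 e0 Hz.
by apply: (response_local r_gt0 _ L0 A0 e0 cl ul cp up
  (response_cst r_gt0 a l01) H Hz); rewrite lerDl.
Qed.

(** l <= l / (1 + r - r l) amounts to r l (1 - l) <= 0. *)
Lemma const_response_fixpoint l : 0 <= l <= 1 -> l <= const_response r l -> l = 0 \/ l = 1.
Proof.
move=> /andP[l0 l1].
have rl : 0 <= r * (1 - l) by rewrite mulr_ge0 ?(ltW r_gt0) ?subr_ge0.
rewrite /const_response ler_pdivlMr; last by lra.
move=> h.
have : l * (r * (1 - l)) <= 0 by lra.
move=> h2.
have : l * (r * (1 - l)) == 0 by rewrite eq_le h2 mulr_ge0.
rewrite !mulf_eq0 (gt_eqF r_gt0)/= => /orP[/eqP ->|]; first by left.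
by rewrite subr_eq0 => /eqP <-; right.
Qed.

Lemma front_cvg_ninfty p : front p ->
  p z @[z --> -oo] --> inf (range p) /\ 0 <= inf (range p) <= 1.
Proof.
move=> [cp up pnd].
have hl : has_lbound (range p) by exists 0 => _ [z _ <-]; case/andP: (up z).
have hi : has_inf (range p) by split => //; exists (p 0), 0.
split.
  apply/cvgrPdist_le => e e0.
  have [_ [z0 _ <-] hz] := inf_adherent e0 hi.
  exists z0; split; first exact: num_real.
  move=> z /ltW/pnd zz0.
  have h : inf (range p) <= p z by apply: ge_inf => //; exists z.
  by rewrite distrC ger0_norm ?subr_ge0//; lra.
apply/andP; split.
  by apply: lb_le_inf; [exists (p 0), 0|move=> _ [z _ <-]; case/andP: (up z)].
by apply: (@le_trans _ _ (p 0)); [apply: ge_inf => //; exists 0|case/andP: (up 0)].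
Qed.

Lemma front_cvg_pinfty p : front p ->
  p z @[z --> +oo] --> sup (range p) /\ 0 <= sup (range p) <= 1.
Proof.
move=> [cp up pnd].
have hu : has_ubound (range p) by exists 1 => _ [z _ <-]; case/andP: (up z).
split; first exact: nondecreasing_cvgr.
apply/andP; split; last first.
  by apply: ge_sup; [exists (p 0), 0|move=> _ [z _ <-]; case/andP: (up z)].
by apply: (@le_trans _ _ (p 0)); [case/andP: (up 0)|apply: ub_le_sup => //; exists 0].
Qed.

(** The limit l at -oo satisfies l <= T l and is less than 1, so it is 0. *)
Lemma sub_front_cvg_ninfty c p z0 : front p -> (forall z, p z <= T c p z) ->
  p z0 < 1 -> p z @[z --> -oo] --> (0 : R).
Proof.
move=> fp pT p1.
have [cl l01] := front_cvg_ninfty fp.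
have := front_map_cvg (PF := proper_ninfty_nbhs) c shiftable_ninfty fp l01 cl => cT.
have lT : inf (range p) <= const_response r (inf (range p)).
  by apply: (ler_cvg_to cl cT (nearW _ pT)).
have [e|e] := const_response_fixpoint l01 lT; first by rewrite -e.
have : inf (range p) <= p z0.
  apply: ge_inf; last by exists z0.
  by exists 0 => _ [z _ <-]; case: fp => _ /(_ z)/andP[].
by rewrite e leNgt p1.
Qed.

Lemma sub_front_cvg_pinfty c p z0 : front p -> (forall z, p z <= T c p z) ->
  0 < p z0 -> p z @[z --> +oo] --> (1 : R).
Proof.
move=> fp pT p1.
have [cl l01] := front_cvg_pinfty fp.
have := front_map_cvg (PF := proper_pinfty_nbhs) c shiftable_pinfty fp l01 cl => cT.
have lT : sup (range p) <= const_response r (sup (range p)).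
  by apply: (ler_cvg_to cl cT (nearW _ pT)).
have [e|e] := const_response_fixpoint l01 lT; last by rewrite -e.
have : p z0 <= sup (range p).
  apply: ub_le_sup; last by exists z0.
  by exists 1 => _ [z _ <-]; case: fp => _ /(_ z)/andP[].
by rewrite e leNgt p1.
Qed.

Lemma ramp_front (k : R) : 0 <= k <= 1 ->
  front (fun z => Num.min 1 (Num.max k z)) /\
  holder 1 (fun z => Num.min 1 (Num.max k z)).
Proof.
move=> /andP[k0 k1].
pose ps z := Num.min 1 (Num.max k z).
have up z : 0 <= ps z <= 1.
  by rewrite /ps le_min ler01 le_max k0 ge_min lexx.
have nd : {homo ps : x y / x <= y}.
  by move=> x y xy; rewrite /ps le_min !ge_min lexx/= ge_max !le_max lexx xy !orbT.
have H : holder 1 ps.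
  move=> x y; wlog yx : x y / y <= x => [W|].
    have [|/ltW] := leP y x; first exact: W.
    by move/W; rewrite distrC (distrC x).
  have h1 : ps x - ps y <= 1 by have /andP[? ?] := up x; have /andP[? ?] := up y; lra.
  have h0 : 0 <= ps x - ps y by rewrite subr_ge0 nd.
  have h2 : ps x - ps y <= x - y.
    have psx : ps x <= Num.max k x by rewrite /ps ge_min lexx orbT.
    rewrite lerBlDr addrC -lerBlDr {2}/ps le_min.
    have /andP[_ u1] := up x.
    apply/andP; split; first lra.
    rewrite le_max; move: psx.
    by case: (leP k x) => ? ?; apply/orP; [right|left]; lra.
  have xy0 : 0 <= x - y by rewrite subr_ge0.
  rewrite mul1r !ger0_norm//.
  rewrite -[leLHS]ger0_norm// -sqrtr_sqr ler_sqrt//.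
  by apply: le_trans h2; rewrite expr2 ler_piMr.
by split=> //; split => //; exact: holder_continuous H.
Qed.

Variable C : R.
Hypothesis C_ge1 : 1 <= C.
Hypothesis T_moduli : forall c p, front p ->
  holder C (T c p) /\ forall c' z, `|T c p z - T c' p z| <= C * Num.sqrt `|c - c'|.

(** Perron's method.  Let psi = min (1, max (1 - k, z)) and let b be the supremum
    of the sub-fronts below psi having the modulus C of the front map; this
    class is closed under suprema.  It contains min (psi, T b), so
    b = min (psi, T b), and b differs from T b by at most k because
    psi >= 1 - k.  The obstacle keeps b from being identically 1, the given
    sub-front q keeps it from being 0, so b goes from 0 to 1 and can be
    translated to take the value 1/2 at 0. *)
Lemma approximate_wave c q : front q -> (forall z, q z <= T c q z) ->
  q z @[z --> -oo] --> (0 : R) -> (exists z, 0 < q z) ->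
  forall k, 0 < k < 1/2 -> exists p, [/\ front p, holder C p, p 0 = 1/2 &
    forall z, `|p z - T c p z| <= k].
Proof.
move=> fq qT q0 [z1 qz1] k /andP[k0 k12].
pose psi z := Num.min 1 (Num.max (1 - k) z).
have k1 : 0 <= 1 - k <= 1 by apply/andP; split; lra.
have [fpsi hpsi] : front psi /\ holder 1 psi := ramp_front k1.
have fTq := front_map_front r_gt0 VM c fq.
pose S := [set p | [/\ front p, holder C p, (forall z, p z <= T c p z) &
                    (forall z, p z <= psi z)]].
have [t [St t0]] : exists t, S (fun z => T c q (z + t)) /\ True.
  have h : T c q z @[z --> -oo] --> (0 : R).
    have := front_map_cvg (PF := proper_ninfty_nbhs) c shiftable_ninfty fq _ q0.
    by rewrite /const_response mul0r; apply; rewrite lexx ler01.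
  have k1' : 0 < 1 - k by lra.
  move/cvgrPdist_le : h => /(_ _ k1')[N [_ HN]].
  (* The obstacle equals 1 for z >= 1; for z < 1 we have z + t < N. *)
  pose t := N - 2; exists t; split => //; split.
  - exact: front_shift.
  - by move=> x y; apply: (le_trans ((T_moduli c fq).1 _ _)); rewrite opprD addrACA subrr addr0.
  - move=> z; rewrite front_map_shift//.
    exact: front_map_le.
  - move=> z; rewrite /psi le_min; case: fTq => _ /(_ (z + t))/andP[h0 h1] _.
    rewrite h1/=; have [zl|zl] := leP 1 z.
      by rewrite le_max (le_trans h1 zl) orbT.
    rewrite le_max; apply/orP; left.
    have := HN (z + t); rewrite sub0r normrN ger0_norm//; apply.
    by rewrite /t; lra.
(* [S] is not empty by [St], so the suprema below are not the default value. *)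
pose b z := sup [set p z | p in S].
have Sub z : has_ubound [set p z | p in S].
  by exists 1 => _ [p [[_ up _] _ _ _] <-]; case/andP: (up z).
have S0 z : [set p z | p in S] !=set0.
  by exists (T c q (z + t)), (fun z => T c q (z + t)).
have pb p z : S p -> p z <= b z by move=> Sp; apply: ub_le_sup => //; exists p.
have bP z x : (forall p, S p -> p z <= x) -> b z <= x.
  by move=> H; apply: ge_sup => // _ [p Sp <-]; exact: H.
have ub : unit_valued b.
  move=> z; apply/andP; split.
    by apply: le_trans (pb _ z St); case: fTq => _ /(_ (z + t))/andP[].
  by apply: bP => p [[_ /(_ z)/andP[]]].
have ndb : {homo b : x y / x <= y}.
  move=> x y xy; apply: bP => p Sp; apply: le_trans (pb p y Sp).
  by case: Sp => -[_ _ pnd] _ _ _; exact: pnd.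
have hb : holder C b.
  have W x y : b x <= b y + C * Num.sqrt `|x - y|.
    apply: bP => p Sp; have := pb p y Sp.
    by case: Sp => _ /(_ x y)/ler_normlP[_ h] _ _; lra.
  move=> x y; rewrite ler_norml; apply/andP; split.
    by have := W y x; rewrite distrC; lra.
  by have := W x y; lra.
have fb : front b by split => //; exact: holder_continuous hb.
have fTb := front_map_front r_gt0 VM c fb.
have bT z : b z <= T c b z.
  apply: bP => p Sp; have [fp _ pT _] := Sp.
  apply: (le_trans (pT z)); apply: front_map_le => // y; exact: pb.
have bpsi z : b z <= psi z by apply: bP => p [_ _ _].
pose b' z := Num.min (psi z) (T c b z).
have bb' z : b z <= b' z by rewrite le_min bpsi bT.
have hb' : holder C b'.
  have hh : holder C psi by apply: holder_le hpsi.
  have W x y : b' x <= b' y + C * Num.sqrt `|x - y|.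
    rewrite /b' -lerBlDr le_min !lerBlDr.
    have /ler_normlP[_ h1] := hh x y; have /ler_normlP[_ h2] := (T_moduli c fb).1 x y.
    apply/andP; split; rewrite ge_min; apply/orP; [left|right]; lra.
  move=> x y; rewrite ler_norml; apply/andP; split.
    by have := W y x; rewrite distrC; lra.
  by have := W x y; lra.
have fb' : front b'.
  split.
  - exact: holder_continuous hb'.
  - move=> z; rewrite /b' le_min ge_min.
    case: fpsi => _ /(_ z)/andP[-> ->] _; case: fTb => _ /(_ z)/andP[-> _] _.
    by [].
  - move=> x y xy.
    have [_ _ /(_ _ _ xy) hp] := fpsi; have [_ _ /(_ _ _ xy) ht] := fTb.
    rewrite {2}/b' le_min; apply/andP; split; [apply: le_trans hp|apply: le_trans ht];
      by rewrite /b' ge_min lexx ?orbT.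
have Sb' : S b'.
  split => //.
  - move=> z; rewrite /b' ge_min; apply/orP; right.
    by apply: front_map_le => //; exact: bb'.
  - by move=> z; rewrite ge_min lexx.
have bE z : b z = b' z by apply/le_anti; rewrite bb' pb.
have bk z : `|b z - T c b z| <= k.
  rewrite distrC ger0_norm ?subr_ge0//.
  have : psi z >= 1 - k by rewrite /psi le_min le_max lexx; case/andP: k1 => _ ->.
  rewrite bE /b'; case: fTb => _ /(_ z)/andP[_ h] _.
  by case: (leP (psi z)); lra.
have b1 : b 0 < 1.
  apply: (le_lt_trans (bpsi 0)).
  apply: (@le_lt_trans _ _ (Num.max (1 - k) 0)).
    by rewrite /psi ge_min lexx orbT.
  by rewrite gt_max; apply/andP; split; lra.
have bl := sub_front_cvg_ninfty fb bT b1.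
have bpos : 0 < b (z1 - t).
  apply: lt_le_trans (pb _ _ St); rewrite subrK.
  exact: lt_le_trans (qT z1).
have br := sub_front_cvg_pinfty fb bT bpos.
have h2 : 0 < 1/2 :> R by lra.
move/cvgrPdist_le : bl => /(_ _ h2)[N1 [_ HN1]].
move/cvgrPdist_le : br => /(_ _ h2)[N2 [_ HN2]].
pose x1 := Num.min N1 N2 - 1; pose x2 := Num.max N1 N2 + 1.
have h1 : b x1 <= 1/2.
  have := HN1 x1; rewrite sub0r normrN => /(_ _)/ler_normlP[].
    by rewrite /x1; case: (leP N1 N2); lra.
  by [].
have h3 : 1/2 <= b x2.
  have := HN2 x2 => /(_ _)/ler_normlP[].
    by rewrite /x2; case: (leP N1 N2); lra.
  lra.
have x12 : x1 <= x2 by rewrite /x1 /x2; case: (leP N1 N2); lra.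
have [||zz _ bz] := @IVT R b x1 x2 (1/2) x12.
- by apply: continuous_subspaceT; case: fb.
- by rewrite ge_min h1 le_max h3 orbT.
exists (fun z => b (z + zz)); split.
- exact: front_shift.
- by move=> x y; apply: (le_trans (hb _ _)); rewrite opprD addrACA subrr addr0.
- by rewrite add0r.
- by move=> z; rewrite front_map_shift.
Qed.

End FrontLimits.

(** * Existence of waves *)

Section Waves.
Context {R : realType}.
Variables (r : R) (V : set R) (M : R -> R).
Hypothesis r_gt0 : 0 < r.
Hypothesis VM : velocity_density V M.
Implicit Types (a c e l L A B C : R) (p q h g : R -> R) (x y z v : R).
Local Notation T := (front_map r V M).

(** Tychonoff's theorem on [0, 1]^R.  A cluster point is close to some p n, with n
    arbitrarily large, at any finitely many points at once; with a common
    modulus of continuity this replaces the extraction of a subsequence. *)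
Lemma pointwise_cluster (p : nat -> R -> R) : (forall n, unit_valued (p n)) ->
  exists q : R -> R, forall m (x : 'I_m -> R) N e, 0 < e ->
    exists2 n, (N <= n)%N & forall i, `|p n (x i) - q (x i)| < e.
Proof.
move=> up.
pose K : set (prod_topology (fun _ : R => R)) := [set f | forall i, `[0, 1]%classic (f i)].
have cK : compact K.
  apply: (@tychonoff R (fun _ : R => R) (fun _ => `[0, 1]%classic)) => _.
  exact: segment_compact.
pose F : set_system (prod_topology (fun _ : R => R)) := p n @[n --> \oo].
have PF : ProperFilter F by apply: fmap_proper_filter.
have FK : \forall n \near \oo, K (p n) by apply: nearW => n z /=; rewrite in_itv/=; exact: up.
have [q [Kq clq]] := cK F PF FK.
exists q => m x N e e0.
have h1 : \forall n \near \oo, [set p n | n in [set n | (N <= n)%N]] (p n).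
  by exists N => // n /= Nn; exists n.
pose near_q := nbhs (q : prod_topology (fun _ : R => R)).
have Fq : Filter near_q by exact: nbhs_filter.
pose B i : set (prod_topology (fun _ : R => R)) := [set f | `|f (x i) - q (x i)| < e].
have hB i : near_q (B i).
  have /cvgrPdist_lt/(_ _ e0) := @proj_continuous R (fun _ : R => R) (x i) q.
  by apply: filterS => f; rewrite /B /proj/= distrC.
have h2 : near_q [set f | forall i, B i f] by exact: (@filter_forall _ 'I_m B near_q Fq hB).
have [_ [[n Nn <-] Hn]] := clq _ _ h1 h2.
by exists n.
Qed.

(** The normalization p 0 = 1/2 excludes the two constant fixed points and survives
    limits. *)
Definition wave c p := [/\ front p, p 0 = 1/2 & forall z, p z = T c p z].

Lemma grid_approximation (A d : R) : 0 <= A -> 0 < d ->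
  exists m (x : 'I_m -> R), forall y, 0 <= y <= A -> exists i, `|y - x i| <= d.
Proof.
move=> A0 d0.
exists (Num.trunc (A / d)).+1, (fun i => i%:R * d) => y /andP[y0 yA].
have yd0 : 0 <= y / d by rewrite divr_ge0// ltW.
have /andP[h1 h2] := truncn_itv yd0.
have lm : (Num.trunc (y / d) < (Num.trunc (A / d)).+1)%N.
  by rewrite ltnS; apply: le_truncn; rewrite ler_pM2r// invr_gt0.
exists (Ordinal lm) => /=.
move: h1 h2; rewrite ler_pdivlMr// ltr_pdivrMr// -natr1 mulrDl mul1r => h1 h2.
by rewrite ger0_norm ?subr_ge0//; lra.
Qed.

Variable C : R.
Hypothesis C_ge1 : 1 <= C.
Hypothesis T_moduli : forall c p, front p ->
  holder C (T c p) /\ forall c' z, `|T c p z - T c' p z| <= C * Num.sqrt `|c - c'|.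

(** Approximating the cluster point on a fine grid of [z - A, z + A] approximates
    it on the whole interval, by the common modulus C, and T depends only
    on this interval up to exp (- A / L). *)
Lemma wave_of_approximate_waves c :
  (forall e, 0 < e -> exists c' p, [/\ `|c - c'| <= e, front p, holder C p, p 0 = 1/2 &
     forall z, `|p z - T c' p z| <= e]) ->
  exists p, wave c p.
Proof.
move=> H.
have /choice[cp Hcp] : forall n : nat, exists cp : R * (R -> R),
    [/\ `|c - cp.1| <= n.+1%:R^-1, front cp.2, holder C cp.2, cp.2 0 = 1/2 &
     forall z, `|cp.2 z - T cp.1 cp.2 z| <= n.+1%:R^-1].
  move=> n; have [|c' [p Hp]] := H n.+1%:R^-1; first by rewrite invr_gt0.
  by exists (c', p).
pose p n := (cp n).2.
have fp n : front (p n) by case: (Hcp n).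
have hp n : holder C (p n) by case: (Hcp n).
have [q Hq] := pointwise_cluster (fun n => let: And3 _ u _ := fp n in u).
have C0 : 0 < C by apply: lt_le_trans C_ge1.
have one x N e : 0 < e -> exists2 n, (N <= n)%N & `|p n x - q x| < e.
  move=> /(Hq 1%N (fun=> x) N)[n Nn Hn]; exists n => //; exact: (Hn ord0).
have two x y e : 0 < e -> exists n, `|p n x - q x| < e /\ `|p n y - q y| < e.
  move=> /(Hq 2%N (fun i => if i == ord0 then x else y) 0%N)[n _ Hn]; exists n.
  by split; [exact: (Hn ord0)|exact: (Hn ord_max)].
have uq : unit_valued q.
  move=> z; apply/andP; split; apply/ler_addgt0Pl => e e0;
    have [n _ /ltr_normlP[h1 h2]] := one z 0%N e e0;
    by have [_ /(_ z)/andP[? ?] _] := fp n; lra.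
have ndq : {homo q : x y / x <= y}.
  move=> x y xy; apply/ler_addgt0Pl => e e0.
  have e2 : 0 < e / 2 by rewrite divr_gt0.
  have [n [/ltr_normlP[h1 h2] /ltr_normlP[h3 h4]]] := two x y _ e2.
  by have [_ _ /(_ _ _ xy) ?] := fp n; lra.
have hq : holder C q.
  move=> x y; apply/ler_addgt0Pl => e e0.
  have e2 : 0 < e / 2 by rewrite divr_gt0.
  have [n [/ltr_normlP[h1 h2] /ltr_normlP[h3 h4]]] := two x y _ e2.
  have /ler_normlP[h5 h6] := hp n x y.
  by apply/ler_normlP; split; lra.
have fq : front q by split => //; exact: holder_continuous hq.
have q0 : q 0 = 1/2.
  have W e : 0 < e -> `|q 0 - 1/2| <= e.
    move=> e0; have [n _ h] := one 0 0%N e e0.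
    have p0 : p n 0 = 1/2 by case: (Hcp n).
    by rewrite distrC -p0 ltW.
  apply/eqP; rewrite -subr_eq0 -normr_le0; apply/ler_addgt0Pl => e e0.
  by rewrite addr0; exact: W.
exists q; split => // z.
have [L L0 HL] := velocity_range VM c.
have W e : 0 < e -> `|q z - T c q z| <= (7 + 2 * r) * e.
  move=> e0.
  pose A := L / e.
  have A0 : 0 <= A by rewrite divr_ge0 ?ltW.
  have expA : expR (- (A / L)) <= e.
    have -> : A / L = e^-1 by rewrite /A mulrAC divff ?gt_eqF// mul1r.
    by rewrite ltW// expRN_inv_lt.
  (* A grid of step s ^ 2 gives an error C * sqrt (s ^ 2) = e / 2. *)
  pose s := e / (2 * C).
  have s0 : 0 < s by rewrite divr_gt0// mulr_gt0.
  have A20 : 0 <= 2 * A by rewrite mulr_ge0.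
  have [m [x Hx]] := grid_approximation A20 (exprn_gt0 2 s0).
  have t0 : 0 < Num.min e ((e / C) ^+ 2) by rewrite lt_min e0 exprn_gt0// divr_gt0.
  have [N HN] : exists N, forall n, (N <= n)%N -> n.+1%:R^-1 <= Num.min e ((e / C) ^+ 2).
    exists (Num.trunc (Num.min e ((e / C) ^+ 2))^-1) => n Nn.
    rewrite -[leRHS]invrK lef_pV2 ?posrE ?invr_gt0//.
    apply/ltW/(lt_le_trans (truncnS_gt _)).
    by rewrite ler_nat ltnS.
  (* The point z itself is added to the grid of [z - A, z + A]. *)
  pose x' (i : 'I_m.+1) := if unlift ord0 i is Some j then x j + (z - A) else z.
  have [n /HN + Hn] := Hq m.+1 x' N e e0.
  rewrite le_min => /andP[n1 n2].
  have [cc _ _ _ pT] := Hcp n.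
  have pz : `|p n z - q z| <= e.
    by have := Hn ord0; rewrite /x' unlift_none => /ltW.
  have ball y : `|y - z| <= A -> `|p n y - q y| <= 2 * e.
    move=> /ler_normlP[y1 y2].
    have [|i Hi] := Hx (y - (z - A)); first by apply/andP; split; lra.
    have := Hn (lift ord0 i); rewrite /x' liftK.
    set xi := x i + (z - A) => hi.
    have yx : `|y - xi| <= s ^+ 2 by rewrite /xi opprD addrA addrAC.
    have hs : C * Num.sqrt `|y - xi| <= e / 2.
      have : Num.sqrt `|y - xi| <= s.
        by apply: sqrtr_le_of_sqr => //; exact: ltW.
      move=> /(ler_wpM2l (ltW C0))/le_trans; apply.
      by rewrite le_eqVlt; apply/orP; left; apply/eqP; rewrite /s; field; rewrite gt_eqF.
    have := hp n y xi; have := hq y xi.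
    move: hi hs => /ltr_normlP[? ?] ? /ler_normlP[? ?] /ler_normlP[? ?].
    by apply/ler_normlP; split; lra.
  have e20 : 0 <= 2 * e by rewrite mulr_ge0// ltW.
  have h1 := front_map_local r_gt0 VM HL L0 A0 e20 (fp n) fq ball.
  have h2 : `|T c (p n) z - T (cp n).1 (p n) z| <= e.
    apply: (le_trans ((T_moduli c (fp n)).2 _ _)).
    rewrite mulrC -ler_pdivlMr//.
    apply: sqrtr_le_of_sqr; first by rewrite divr_ge0 ?ltW.
    exact: le_trans n2.
  have h3 := le_trans (pT z) n1.
  move: h1 h2 h3 pz; rewrite -/(p n).
  move=> /ler_normlP[? ?] /ler_normlP[? ?] /ler_normlP[? ?] /ler_normlP[? ?].
  by apply/ler_normlP; split; lra.
apply/eqP; rewrite -subr_eq0 -normr_le0; apply/ler_addgt0Pl => e e0.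
rewrite addr0.
have k0 : 0 < 7 + 2 * r by rewrite addr_gt0// mulr_gt0.
apply: (le_trans (W (e / (7 + 2 * r)) _)); first by rewrite divr_gt0.
by rewrite mulrC divfK// gt_eqF.
Qed.

Lemma wave_of_sub_front c q : front q -> (forall z, q z <= T c q z) ->
  q z @[z --> -oo] --> (0 : R) -> (exists z, 0 < q z) -> exists p, wave c p.
Proof.
move=> fq qT q0 q1; apply: wave_of_approximate_waves => e e0.
have [|p [fp hp p0 pT]] :=
  approximate_wave r_gt0 VM C_ge1 T_moduli fq qT q0 q1 (k := Num.min e (1/3)).
  by rewrite lt_min e0 gt_min; apply/andP; split; [lra|apply/orP; right; lra].
exists c, p; split => //; first by rewrite subrr normr0 ltW.
by move=> z; apply: (le_trans (pT z)); rewrite ge_min lexx.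
Qed.

Lemma wave_cvg c p : wave c p ->
  p z @[z --> -oo] --> (0 : R) /\ p z @[z --> +oo] --> (1 : R).
Proof.
move=> [fp p0 pT].
have pT' z : p z <= T c p z by rewrite -pT.
split.
- by apply: (sub_front_cvg_ninfty r_gt0 VM fp pT' (z0 := 0)); rewrite p0; lra.
- by apply: (sub_front_cvg_pinfty r_gt0 VM fp pT' (z0 := 0)); rewrite p0; lra.
Qed.

Lemma wave_speed_closed c :
  (forall e, 0 < e -> exists c' p, `|c - c'| <= e /\ wave c' p) ->
  exists p, wave c p.
Proof.
move=> H; apply: wave_of_approximate_waves => e e0.
have [c' [p [cc [fp p0 pT]]]] := H e e0.
exists c', p; split => //.
- by move=> x y; rewrite pT (pT y); exact: (T_moduli c' fp).1.
- by move=> z; rewrite -pT subrr normr0 ltW.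
Qed.

(** The front map increases with the speed, so a wave of speed c is a sub-front at
    speed c'. *)
Lemma wave_speed_up c c' p : wave c p -> c <= c' -> exists p', wave c' p'.
Proof.
move=> w cc; have [fp p0 pT] := w.
apply: (wave_of_sub_front (q := p)) => //.
- by move=> z; rewrite {1}pT; exact: front_map_speed_le.
- by case: (wave_cvg w).
- by exists 0; rewrite p0; lra.
Qed.

(** At speed c = sup V - 1 / (2 l) the barrier of [exponential_sub_response] has
    coefficient (1 + r) / (1/2 + l (sup V - v)), at most
    (1 + r) / sqrt (2 l (sup V - v)) by the inequality between the arithmetic
    and geometric means.  Its average is at most 1 for l large, which makes
    max (0, 1 - exp (- l z)) a sub-front. *)
Lemma wave_near_max_speed (vm : R) : 0 < vm -> (forall v, V v -> v <= vm) ->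
  exists2 c, 0 <= c < vm & exists p, wave c p.
Proof.
move=> vm0 Vvm.
have [A A0 HA] := avg_inv_sqrt VM.
pose bA := (1 + r) * A.
have r1 : 0 < 1 + r by rewrite addr_gt0.
have bA0 : 0 < bA by rewrite mulr_gt0.
(* s = 2 l: the first term makes the average of the barrier at most 1, the
   second one makes the speed vm - 1 / s nonnegative. *)
pose s := bA ^+ 2 + vm^-1.
have s0 : 0 < s by rewrite addr_gt0 ?exprn_gt0 ?invr_gt0.
pose l := s / 2.
have l0 : 0 < l by rewrite divr_gt0.
have sV : s^-1 <= vm.
  by rewrite -[leRHS]invrK lef_pV2 ?posrE ?invr_gt0// lerDr exprn_ge0// ltW.
have sbA : bA <= Num.sqrt s.
  apply: le_sqrtr_of_sqr; first exact: ltW.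
  by rewrite lerDl invr_ge0 ltW.
exists (vm - s^-1); first by rewrite subr_ge0 sV/= gtrBl invr_gt0.
pose E z := expR (- (l * z)).
pose p z := Num.max 0 (1 - E z).
have dE z : is_derive z 1 E (E z * - (l * 1)) := der_expR (derN (derMl l (der_id z))).
have fp : front p.
  split.
  - move=> z.
    apply: (@continuous_max R R (fun=> 0) (fun z => 1 - E z) z); first exact: cvg_cst.
    apply: cvgB; first exact: cvg_cst.
    exact: is_derive_continuous (dE z).
  - move=> z; rewrite /p le_max lexx/= ge_max ler01/=.
    by rewrite gerBl expR_ge0.
  - move=> x y xy; rewrite /p ge_max !le_max lexx/= lerD2l lerN2 ler_expR lerN2.
    by rewrite ler_wpM2l ?(ltW l0)// orbT.
have [cp up pnd] := fp.
apply: (wave_of_sub_front (q := p)) => //.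
- move=> z.
  rewrite {1}/p ge_max; apply/andP; split.
    by have [_ /(_ z)/andP[]] := front_map_front r_gt0 VM (vm - s^-1) fp.
  have wE := avg_integrableZ VM ((1 + r) / Num.sqrt s * E z) (avg_integrable_inv_sqrt VM vm).
  have E0 : 0 < E z by exact: expR_gt0.
  apply: (@le_trans _ _ (avg V M (fun v => 1 - (1 + r) / Num.sqrt s * E z * inv_sqrt vm v))).
    rewrite avgB ?avg_integrable_cst// avg_cst// avgZ//; last exact: avg_integrable_inv_sqrt.
    rewrite lerD2l lerN2 mulrAC -[leRHS]mul1r ler_pM2r//.
    rewrite mulrAC ler_pdivrMr ?sqrtr_gt0// mul1r.
    by apply: le_trans sbA; rewrite /bA ler_pM2l.
  apply: (@avg_le _ _ _ VM vm).
  + exact: avg_integrableB (avg_integrable_cst VM _) wE.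
  + exact: avg_integrable_response.
  move=> v Vv vvm.
  have x0 : 0 < vm - v by rewrite subr_gt0 lt_neqAle vvm Vvm.
  have den : 1 - l * (v - (vm - s^-1)) = 1/2 + l * (vm - v).
    rewrite /l; field; exact: lt0r_neq0.
  have lx : 0 < l * (vm - v) by rewrite mulr_gt0.
  have la : l * (v - (vm - s^-1)) < 1 by rewrite -subr_gt0 den; lra.
  apply: le_trans (exponential_sub_response r_gt0 l0 la _ cp up (responseP r_gt0 _ cp up) z) => //.
  rewrite lerD2l lerN2 -/(E z) [leRHS]mulrAC ler_pM2r// den -[leRHS]mulrA (ler_pM2l r1).
  rewrite /inv_sqrt distrC gtr0_norm// -invfM lef_pV2 ?posrE ?mulr_gt0 ?sqrtr_gt0//; last by lra.
  rewrite -sqrtrM ?(ltW s0)//.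
  have b0 : 0 <= 1 / 2 + l * (vm - v) by lra.
  apply: sqrtr_le_of_sqr => //.
  have := sqr_ge0 (1/2 - l * (vm - v)).
  by rewrite /l; lra.
- apply/cvgrPdist_le => e e0; exists 0; split; first exact: num_real.
  move=> z z0.
  have E1 : 1 - E z <= 0.
    have := expR_ge1Dx (- (l * z)); rewrite -/(E z).
    have : 0 <= l * (- z) by rewrite mulr_ge0 ?(ltW l0)// oppr_ge0 ltW.
    lra.
  by rewrite /p (max_l E1) subrr normr0 ltW.
- exists 1; rewrite /p lt_max; apply/orP; right.
  by rewrite subr_gt0 /E mulr1 -[ltRHS]expR0 ltr_expR oppr_lt0.
Qed.

End Waves.

(** * Speed zero, and sub-fronts from profiles *)

Section SpeedBounds.
Context {R : realType}.
Variables (r : R) (V : set R) (M : R -> R).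
Hypothesis r_gt0 : 0 < r.
Hypothesis VM : velocity_density V M.
Implicit Types (a c e l L A B C : R) (p q h g : R -> R) (x y z v : R).
Local Notation T := (front_map r V M).
Notation mu := (@lebesgue_measure R).

Lemma avg_integrable_id_mul g (B : R) : measurable_fun V g ->
  (forall v, V v -> `|g v| <= B) -> avg_integrable V M (fun v => v * g v).
Proof.
move=> mg gB; have [W W0 HW] := velocities_bounded VM.
apply: (avg_integrable_bounded VM (B := W * B)).
  by apply: measurable_funM => //; exact: measurable_id.
by move=> v Vv; rewrite normrM ler_pM// ?HW// gB.
Qed.

(** The flux J, the average of v h, satisfies J' = - r p (1 - p) <= 0.  It
    tends to 0 at -oo, where h -> 0, and to the mean velocity 0 at +oo, where
    h -> 1.  Hence J = 0, so p (1 - p) = 0 everywhere, against p 0 = 1/2. *)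
Lemma no_wave_zero p : (\int[mu]_(v in V) (v * M v)%:E = 0%:E)%E ->
  ~ wave r V M 0 p.
Proof.
move=> M_mean w; have [fp p0 pT] := w; have [cp up pnd] := fp.
have [pl pr] := wave_cvg r_gt0 VM w.
have [W W0 HW] := velocities_bounded VM.
pose h z v := response r (v - 0) p z.
have Rh v : is_response r (v - 0) p (h ^~ v) by exact: responseP.
have wh z : avg_integrable V M (h z) by exact: avg_integrable_response.
have h01 z v : 0 <= h z v <= 1 by case: (Rh v z).
have mh z : measurable_fun V (h z).
  apply: nonincreasing_measurable.
    exact: compact_measurable (density_compact VM).
  move=> v1 v2 v12.
  apply: (response_nonincreasing_velocity r_gt0 cp up pnd (Rh v1) (Rh v2)).
  by rewrite lerD2r.
have wvh z : avg_integrable V M (fun v => v * h z v).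
  apply: (@avg_integrable_id_mul _ 1) => // v _.
  by have /andP[? ?] := h01 z v; rewrite ger0_norm.
pose J z := avg V M (fun v => v * h z v).
pose dJ z := avg V M (fun v => p z - rate r p z * h z v).
have wd z : avg_integrable V M (fun v => p z - rate r p z * h z v).
  exact: avg_integrableB (avg_integrable_cst VM _) (avg_integrableZ VM _ (wh z)).
have hJ z : is_derive z 1 J (dJ z).
  apply: (@derive_avg _ _ _ VM (fun z v => v * h z v)
    (fun z v => p z - rate r p z * h z v) (fun=> 1 + r) 0) => //.
  - exact: avg_integrable_cst.
  - move=> v Vv v0 x; have [_ [d]] := Rh v x.
    rewrite subr0 => /(_ v0) hd <-; rewrite addrK.
    exact: derMl.
  - move=> v Vv v0 x; have [_ [d hd e]] := Rh v x.
    by rewrite -e addrK; exact: (response_slope r_gt0 up (Rh v) e).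
(* This is where p = T p is used: the average of h is p itself. *)
have dJE z : dJ z = - (r * p z * (1 - p z)).
  rewrite /dJ avgB//; [|exact: avg_integrable_cst|exact: avg_integrableZ].
  by rewrite avg_cst// avgZ// -[avg V M (h z)]pT /rate; ring.
have Jni x y : x <= y -> J y <= J x.
  move=> xy; apply: le_of_derive_le0 => // t _; exists (dJ t) => //.
  have /andP[? ?] := up t.
  by rewrite dJE oppr_le0 !mulr_ge0 ?subr_ge0// ltW.
have wW g : avg_integrable V M g -> avg_integrable V M (fun v => W * g v) by move=> ?; exact: avg_integrableZ.
have Jl z : J z <= W * p z.
  rewrite pT -avgZ//; last exact: wh.
  apply: (avg_le_pos VM) => //; first exact: wW (wh z).
  move=> v Vv _; have /andP[? ?] := h01 z v.
  by rewrite ler_wpM2r// (le_trans (ler_norm v))// HW.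
have wid : avg_integrable V M (fun v => v) by exact: (avg_integrable_bounded VM (B := W)).
have Jr z : - (W * (1 - p z)) <= J z.
  have E0 : avg V M (fun v => v) = 0.
    by rewrite /avg /Rintegral; under eq_integral do rewrite mulrC; rewrite M_mean.
  have -> : J z = J z - avg V M (fun v => v) by rewrite E0 subr0.
  rewrite -avgB//.
  have -> : - (W * (1 - p z)) = avg V M (fun v => - W * (1 - h z v)).
    rewrite avgZ//; last exact: avg_integrableB (avg_integrable_cst VM _) (wh z).
    by rewrite avgB//; [rewrite avg_cst// -[avg V M (h z)]pT mulNr|exact: avg_integrable_cst].
  apply: (avg_le_pos VM).
  - apply: avg_integrableZ => //; exact: avg_integrableB (avg_integrable_cst VM _) (wh z).
  - exact: avg_integrableB.
  move=> v Vv _; have /andP[? ?] := h01 z v.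
  have -> : v * h z v - v = - v * (1 - h z v) by ring.
  rewrite ler_wpM2r ?subr_ge0// lerN2 (le_trans (ler_norm v))//; exact: HW.
have J0 z : J z = 0.
  apply/le_anti/andP; split; apply/ler_addgt0Pl => e e0; rewrite ?addr0.
    have e1 : 0 < e / W by rewrite divr_gt0.
    move/cvgrPdist_le : pl => /(_ _ e1)[N [_ HN]].
    pose y := Num.min (N - 1) z.
    have yN : y < N by rewrite /y gt_min; apply/orP; left; lra.
    apply: (le_trans (Jni y z _)); first by rewrite ge_min lexx orbT.
    apply: (le_trans (Jl y)); rewrite mulrC -ler_pdivlMr//.
    have := HN y yN; rewrite sub0r normrN; apply: le_trans.
    exact: ler_norm.
  rewrite -lerBlDl sub0r.
  have e1 : 0 < e / W by rewrite divr_gt0.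
  move/cvgrPdist_le : pr => /(_ _ e1)[N [_ HN]].
  pose y := Num.max (N + 1) z.
  have yN : N < y by rewrite /y lt_max; apply/orP; left; lra.
  apply: (@le_trans _ _ (J y)); last by apply: Jni; rewrite le_max lexx orbT.
  apply: le_trans (Jr y); rewrite lerN2 mulrC -ler_pdivlMr//.
  by apply: le_trans (HN y yN); exact: ler_norm.
have : dJ 0 = 0.
  apply: (der_unique (hJ 0)); have -> : J = fun=> 0 by apply/funext.
  exact: der_cst.
rewrite dJE p0 => e0.
by clear M_mean; have := r_gt0; lra.
Qed.

(** The supremum q of p over ]-oo, z] is nondecreasing, has the same modulus and
    the same limits as p.  The h of the profile at any y <= z is a translate of
    a response to data below q, hence is below the response to q. *)
Lemma sub_front_of_profile c (h : R -> R -> R) p :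
  (forall z, avg_integrable V M (h z)) ->
  (forall z v, V v -> 0 <= h z v <= 1) ->
  (forall z, p z = avg V M (h z)) ->
  (forall v, V v -> 0 < M v -> is_response r (v - c) p (h ^~ v)) ->
  (forall z v, M v = 0 -> h z v = 1) ->
  (forall v, V v -> 0 < M v -> h z v @[z --> -oo] --> (0 : R) /\ h z v @[z --> +oo] --> (1 : R)) ->
  exists q, [/\ front q, (forall z, q z <= T c q z),
     q z @[z --> -oo] --> (0 : R) & (exists z, 0 < q z)].
Proof.
move=> wh h01 pE Rh h1 hl.
have up : unit_valued p.
  by move=> z; rewrite pE; apply: avg_unit => // v; exact: h01.
have [A A0 HA] := avg_dist_inv_sqrt VM.
pose C := Num.sqrt (1 + r) * A.
have r1 : 0 <= 1 + r by rewrite addr_ge0// ltW.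
have hp : holder C p.
  move=> x y; rewrite !pE /C mulrAC -sqrtrM//.
  apply: (HA c) => //.
  move=> v Vv vc.
  have := density_ge0 VM Vv; rewrite le_eqVlt => /predU1P[e|Mv].
    by rewrite !h1// subrr normr0 mulr_ge0 ?sqrtr_ge0 ?inv_sqrt_ge0.
  have H := Rh v Vv Mv.
  rewrite -[(1 + r) * _]mul1r; apply: le_sqrt_interpolation => //.
  - by rewrite mulr_ge0.
  - by rewrite normr_gt0 subr_eq0.
  - exact (response_dist_unit x y H H).
  - exact (response_lipschitz r_gt0 x y up H).
have hB n (u : R^nat) v : V v -> `|h (u n) v| <= 1.
  by move=> /(h01 (u n))/andP[? ?]; rewrite ger0_norm.
have pl : p z @[z --> -oo] --> (0 : R).
  apply/cvg_ninftyP => u uoo; rewrite -(avg_cst VM 0).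
  under eq_cvg do rewrite pE.
  apply: (avg_cvg VM (B := 1)) => //; first exact: avg_integrable_cst.
    by move=> n v; exact: hB.
  move=> v Vv Mv; have [+ _] := hl v Vv Mv.
  by move=> /cvg_ninftyP; apply.
have pr : p z @[z --> +oo] --> (1 : R).
  apply/cvg_pinftyP => u uoo; rewrite -(avg_cst VM 1).
  under eq_cvg do rewrite pE.
  apply: (avg_cvg VM (B := 1)) => //; first exact: avg_integrable_cst.
    by move=> n v; exact: hB.
  move=> v Vv Mv; have [_] := hl v Vv Mv.
  by move=> /cvg_pinftyP; apply.
pose q z := sup [set p y | y in [set y | y <= z]].
have Sub z : has_ubound [set p y | y in [set y | y <= z]].
  by exists 1 => _ [y _ <-]; case/andP: (up y).
have S0 z : [set p y | y in [set y | y <= z]] !=set0 by exists (p z), z => /=.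
have pq y z : y <= z -> p y <= q z by move=> yz; apply: ub_le_sup => //; exists y.
have qP z x : (forall y, y <= z -> p y <= x) -> q z <= x.
  by move=> H; apply: ge_sup => // _ [y yz <-]; exact: H.
have uq : unit_valued q.
  move=> z; apply/andP; split.
    by apply: le_trans (pq z z _); case/andP: (up z).
  by apply: qP => y _; case/andP: (up y).
have ndq : {homo q : x y / x <= y}.
  by move=> x y xy; apply: qP => t tx; apply: pq; exact: le_trans xy.
have hq : holder C q.
  have W x y : q x <= q y + C * Num.sqrt `|x - y|.
    apply: qP => t tx.
    have h2 : p (t + (y - x)) <= q y by apply: pq; lra.
    have := hp t (t + (y - x)).
    have -> : t - (t + (y - x)) = x - y by ring.
    by move=> /ler_normlP[_ h3]; lra.
  move=> x y; rewrite ler_norml; apply/andP; split.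
    by have := W y x; rewrite distrC; lra.
  by have := W x y; lra.
have fq : front q by split => //; exact: holder_continuous hq.
exists q; split => //.
- move=> z; apply: qP => y yz; rewrite pE.
  apply: (avg_le_pos VM) => //; first exact: avg_integrable_response.
  move=> v Vv Mv.
  have [cq _ _] := fq.
  have H := is_response_shift (y - z) (Rh v Vv Mv).
  have pq' t : p (t + (y - z)) <= q t by apply: pq; lra.
  have := response_le r_gt0 cq uq H (responseP r_gt0 _ cq uq) pq' z.
  by rewrite addrC subrK.
- apply/cvgrPdist_le => e e0.
  move/cvgrPdist_le : pl => /(_ _ e0)[N [_ HN]].
  exists N; split; first exact: num_real.
  move=> z zN; rewrite sub0r normrN ger0_norm; last by case/andP: (uq z).
  apply: qP => y yz; have := HN y (le_lt_trans yz zN).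
  by rewrite sub0r normrN; apply: le_trans; exact: ler_norm.
- have h2 : 0 < 1/2 :> R by lra.
  move/cvgrPdist_le : pr => /(_ _ h2)[N [_ HN]].
  exists (N + 1); apply: lt_le_trans (pq _ _ (lexx _)).
  have /ler_normlP[_ h3] := HN (N + 1) ltac:(lra).
  lra.
Qed.

End SpeedBounds.

(** * Functions of position and velocity, Hoelder in position *)

Section BoundedHolder.
Context {R : realType}.
Implicit Types (u w : R -> R -> R) (p : R -> R) (B C : R) (z v : R).

Definition bounded_fun2 u := exists B : R, forall z v : R, `|u z v| <= B.

Definition bounded_holder u := bounded_fun2 u /\ exists C : R, forall v, holder C (u ^~ v).

Lemma bounded_fun2D u w : bounded_fun2 u -> bounded_fun2 w -> bounded_fun2 (fun z v => u z v + w z v).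
Proof.
move=> [B HB] [C HC]; exists (B + C) => z v.
by rewrite (le_trans (ler_normD _ _))// lerD.
Qed.

Lemma bounded_fun2M u w : bounded_fun2 u -> bounded_fun2 w -> bounded_fun2 (fun z v => u z v * w z v).
Proof.
by move=> [B HB] [C HC]; exists (B * C) => z v; rewrite normrM ler_pM.
Qed.

Lemma bounded_fun2_cst (b : R) : bounded_fun2 (fun _ _ => b).
Proof. by exists `|b|. Qed.

Lemma bounded_holder_cst (b : R) : bounded_holder (fun _ _ => b).
Proof.
split; first exact: bounded_fun2_cst.
by exists 0 => v x y; rewrite subrr normr0 mul0r.
Qed.

Lemma bounded_holderD u w : bounded_holder u -> bounded_holder w -> bounded_holder (fun z v => u z v + w z v).
Proof.
move=> [bu [B HB]] [bw [C HC]]; split; first exact: bounded_fun2D.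
exists (B + C) => v x y; rewrite /= opprD addrACA [leRHS]mulrDl.
by apply: (le_trans (ler_normD _ _)); apply: lerD; [exact: HB|exact: HC].
Qed.

Lemma bounded_holderM u w : bounded_holder u -> bounded_holder w -> bounded_holder (fun z v => u z v * w z v).
Proof.
move=> [[Bu HBu] [B HB]] [[Bw HBw] [C HC]]; split; first by apply: bounded_fun2M; [exists Bu|exists Bw].
exists (Bu * C + B * Bw) => v x y /=.
have -> : u x v * w x v - u y v * w y v =
  u x v * (w x v - w y v) + (u x v - u y v) * w y v by ring.
rewrite [leRHS]mulrDl; apply: (le_trans (ler_normD _ _)); apply: lerD; rewrite normrM.
  by rewrite -mulrA; apply: ler_pM => //; exact: HC.
by rewrite mulrAC; apply: ler_pM => //; exact: HB.
Qed.

Lemma bounded_holder_continuous u v : bounded_holder u -> continuous (u ^~ v).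
Proof. by move=> [_ [C H]]; exact: holder_continuous (H v). Qed.

(** Uniformity in z is what, together with continuity in z for each v, gives joint
    continuity. *)
Definition velocity_ucont u (v0 : R) := forall e : R, 0 < e ->
  \forall v \near v0, forall z, `|u z v - u z v0| <= e.

Lemma velocity_ucont_cst p (v0 : R) : velocity_ucont (fun z _ => p z) v0.
Proof.
by move=> e e0; near=> v => z; rewrite subrr normr0 ltW.
Unshelve. all: end_near. Qed.

Lemma velocity_ucontD u w (v0 : R) : velocity_ucont u v0 -> velocity_ucont w v0 ->
  velocity_ucont (fun z v => u z v + w z v) v0.
Proof.
move=> hu hw e e0.
have e2 : 0 < e / 2 by rewrite divr_gt0.
near=> v => z; rewrite opprD addrACA (splitr e).
apply: (le_trans (ler_normD _ _)); apply: lerD; move: z; near: v; [exact: hu|exact: hw].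
Unshelve. all: end_near. Qed.

Lemma velocity_ucontM u w (v0 : R) : bounded_fun2 u -> bounded_fun2 w ->
  velocity_ucont u v0 -> velocity_ucont w v0 ->
  velocity_ucont (fun z v => u z v * w z v) v0.
Proof.
move=> [Bu Hu] [Bw Hw] hu hw e e0.
pose B := `|Bu| + `|Bw| + 1.
have B0 : 0 < B by rewrite ltr_wpDl// addr_ge0.
have Hu' z v : `|u z v| <= B
  by apply: (le_trans (Hu z v)); have := ler_norm Bu; have := normr_ge0 Bw; rewrite /B; lra.
have Hw' z v : `|w z v| <= B
  by apply: (le_trans (Hw z v)); have := ler_norm Bw; have := normr_ge0 Bu; rewrite /B; lra.
have e2 : 0 < e / 2 / B by rewrite !divr_gt0.
near=> v => z.
have -> : u z v * w z v - u z v0 * w z v0 =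
  u z v * (w z v - w z v0) + w z v0 * (u z v - u z v0) by ring.
rewrite (splitr e); apply: (le_trans (ler_normD _ _)).
apply: lerD; rewrite normrM.
- apply: (@le_trans _ _ (B * (e / 2 / B))).
    by apply: ler_pM => //; move: z; near: v; exact: hw.
  by rewrite mulrC divfK// gt_eqF.
- apply: (@le_trans _ _ (B * (e / 2 / B))).
    by apply: ler_pM => //; move: z; near: v; exact: hu.
  by rewrite mulrC divfK// gt_eqF.
Unshelve. all: end_near. Qed.

Lemma jointly_continuous_of_velocity_ucont u : bounded_holder u -> (forall v, velocity_ucont u v) ->
  continuous (fun q : R * R => u q.1 q.2).
Proof.
move=> nu hu [z0 v0]; apply/cvgrPdist_le => e e0 /=.
have e2 : 0 < e / 2 by rewrite divr_gt0.
have cu : continuous (u ^~ v0) := bounded_holder_continuous nu.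
exists ([set z | `|u z0 v0 - u z v0| <= e / 2], [set v | forall z, `|u z v - u z v0| <= e / 2]).
  split; last exact: hu.
  by move/cvgrPdist_le : (cu z0) => /(_ _ e2).
move=> [z v] /= [h1 h2].
have -> : u z0 v0 - u z v = (u z0 v0 - u z v0) - (u z v - u z v0) by ring.
rewrite (splitr e); apply: (le_trans (ler_normB _ _)).
by apply: lerD.
Qed.

End BoundedHolder.

(** * Regularity gained by averaging *)

Section Levels.
Context {R : realType}.
Variables (r : R) (V : set R) (M : R -> R).
Hypothesis r_gt0 : 0 < r.
Hypothesis VM : velocity_density V M.
Variables (c : R) (p : R -> R).
Hypothesis p_unit : unit_valued p.
Hypothesis p_holder : bounded_holder (fun z _ : R => p z).
Implicit Types (S u : R -> R -> R) (B C : R) (z v : R).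
Local Notation k := (rate r p).

Let p_cont : continuous p.
Proof. exact: (bounded_holder_continuous (v := 0) p_holder). Qed.

Let k_cont : continuous k.
Proof. exact: rate_continuous. Qed.

Let k_ge1 : forall y, 1 <= k y.
Proof. exact: rate_ge1. Qed.

Let k_holder : bounded_holder (fun z _ => k z).
Proof.
have h := bounded_holderD (bounded_holder_cst (1 + r)) (bounded_holderM (bounded_holder_cst (- r)) p_holder).
by move: h; congr bounded_holder; apply/funext => z; apply/funext => v; rewrite /rate mulNr.
Qed.

Definition slope S u z v : R := (S z v - k z * u z v) / (v - c).

(** At v = c the equation is algebraic.  The functions considered are h and its
    first two derivatives in z; each solves such an equation whose source S
    involves the previous ones. *)
Definition transport_level S u :=
  (forall z v, v != c -> is_derive z 1 (u ^~ v) (slope S u z v)) /\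
  (forall z, k z * u z c = S z c).

Lemma slope_eq S u z v : transport_level S u ->
  (v - c) * slope S u z v + k z * u z v = S z v.
Proof.
move=> [_ uc]; rewrite /slope; have [->|vc] := eqVneq v c.
  by rewrite subrr mul0r add0r.
by rewrite mulrC divfK ?subrK// subr_eq0.
Qed.

Lemma level_derive S u z v : transport_level S u -> v - c != 0 ->
  is_derive z 1 (u ^~ v) (slope S u z v).
Proof. by move=> [hu _]; rewrite subr_eq0; exact: hu. Qed.

(** A translate of u minus u solves an equation with Hoelder source, so the
    modulus is uniform in v, including near v = c. *)
Lemma level_bounded_holder S u : bounded_holder S -> bounded_fun2 u -> transport_level S u -> bounded_holder u.
Proof.
move=> [_ [CS HS]] [B HB] hu; split; first by exists B.
have [_ [Cp Hp]] := p_holder.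
exists (CS + r * Cp * B) => v x y.
pose t := x - y.
have kt : continuous (fun z => k (z + t)) by exact: continuous_shift.
have := @max_principle_abs R (v - c) ((CS + r * Cp * B) * Num.sqrt `|t|) (2 * B)
  (fun z => k (z + t)) (fun z => u (z + t) v - u z v) kt (fun z => k_ge1 _).
have yt : y + t = x by rewrite /t; ring.
move=> /(_ _ _ y); rewrite yt; apply.
- move=> z; exists (slope S u (z + t) v - slope S u z v).
    by move=> vc; apply: derB; [apply: (@der_shift R (u ^~ v) z t)|]; apply: (level_derive _ hu vc).
  have -> : (v - c) * (slope S u (z + t) v - slope S u z v) + k (z + t) * (u (z + t) v - u z v)
    = (S (z + t) v - S z v) + r * (p (z + t) - p z) * u z v.
    by rewrite -!(slope_eq _ _ hu) /rate; ring.
  have e : z + t - z = t by ring.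
  rewrite [leRHS]mulrDl; apply: (le_trans (ler_normD _ _)); apply: lerD.
    by have := HS v (z + t) z; rewrite /= e.
  have := Hp 0 (z + t) z; rewrite /= e => h1.
  rewrite !normrM (gtr0_norm r_gt0) -!mulrA ler_pM2l// (mulrC B) mulrA.
  by apply: ler_pM.
- by move=> z; rewrite (le_trans (ler_normB _ _))// mulr_natl mulr2n lerD.
Qed.

Lemma level_residual_bounded_holder S u : bounded_holder S -> bounded_fun2 u -> transport_level S u ->
  bounded_holder (fun z v => S z v - k z * u z v).
Proof.
move=> nS bu hu; have nu := level_bounded_holder nS bu hu.
have h := bounded_holderD nS (bounded_holderM (bounded_holder_cst (-1)) (bounded_holderM k_holder nu)).
by move: h; congr bounded_holder; apply/funext => z; apply/funext => v; rewrite mulN1r.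
Qed.

(** By the mean value theorem on [z, z + |v - c|], the residual (v - c) u' equals, up
    to sign and at some point t of this interval, an increment of u over the length |v - c|.
    Both this increment and the variation of the residual between t and z are
    of order |v - c|^(1/2). *)
Lemma level_residual_le S u : bounded_holder S -> bounded_fun2 u -> transport_level S u ->
  exists2 K, 0 <= K & forall z v, `|S z v - k z * u z v| <= K * Num.sqrt `|v - c|.
Proof.
move=> nS bu hu.
have [_ [C1 H1]] := level_bounded_holder nS bu hu.
have [_ [C3 H3]] := level_residual_bounded_holder nS bu hu.
exists (`|C1| + `|C3|); first exact: addr_ge0.
move=> z v; have [->|vc] := eqVneq v c.
  by rewrite hu.2 !subrr !normr0 sqrtr0 mulr0 lexx.
have vc0 : v - c != 0 by rewrite subr_eq0.
set a := `|v - c|.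
have za : z <= z + a by rewrite lerDl /a.
have [t /andP[zt ta] e] := MVT_is_derive za (fun t _ => level_derive t hu vc0).
have sE := slope_eq t v hu.
have e1 : `|S t v - k t * u t v| = `|u (z + a) v - u z v|.
  have -> : S t v - k t * u t v = (v - c) * slope S u t v by rewrite -sE; ring.
  have e2 : z + a - z = a by ring.
  by rewrite e e2 normrM [RHS]normrM mulrC /a normr_id.
have h1 : `|u (z + a) v - u z v| <= `|C1| * Num.sqrt a.
  have -> : Num.sqrt a = Num.sqrt `|z + a - z|.
    by congr Num.sqrt; rewrite addrC addKr normr_id.
  by apply: (le_trans (H1 v _ _)); rewrite ler_wpM2r ?sqrtr_ge0// ler_norm.
have h3 : `|(S z v - k z * u z v) - (S t v - k t * u t v)| <= `|C3| * Num.sqrt a.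
  apply: (le_trans (H3 v z t)); apply: (@le_trans _ _ (`|C3| * Num.sqrt `|z - t|)).
    by rewrite ler_wpM2r ?sqrtr_ge0// ler_norm.
  rewrite ler_wpM2l// ler_sqrt ?normr_ge0//.
  by rewrite ler_norml; apply/andP; split; lra.
rewrite [leRHS]mulrDl.
have -> : S z v - k z * u z v = (S t v - k t * u t v) +
   ((S z v - k z * u z v) - (S t v - k t * u t v)) by ring.
by apply: (le_trans (ler_normD _ _)); apply: lerD; [rewrite e1|].
Qed.

Lemma level_slope_le S u : bounded_holder S -> bounded_fun2 u -> transport_level S u ->
  exists2 K, 0 <= K & forall z v, `|slope S u z v| <= K * inv_sqrt c v.
Proof.
move=> nS bu hu; have [K K0 HK] := level_residual_le nS bu hu.
exists K => // z v; have [->|vc] := eqVneq v c.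
  by rewrite /slope subrr invr0 mulr0 normr0 mulr_ge0// inv_sqrt_ge0.
have vc0 : 0 < `|v - c| by rewrite normr_gt0 subr_eq0.
rewrite /slope normrM normfV ler_pdivrMr//.
by rewrite -mulrA [X in K * X]mulrC inv_sqrt_sqr.
Qed.

Lemma measurable_slope S u z : measurable_fun setT (S z) ->
  measurable_fun setT (u z) -> measurable_fun setT (slope S u z).
Proof.
move=> mS mu; apply: measurable_funM.
  by apply: measurable_funB => //; apply: measurable_funM.
apply: (@measurable_off_point _ _ c) => v vc.
apply: cvgV; first by rewrite subr_eq0.
by apply: cvgB; [exact: cvg_id|exact: cvg_cst].
Qed.

Lemma avg_integrable_inv_sqrt_dominated (g : R -> R) (K : R) : measurable_fun setT g ->
  (forall v : R, `|g v| <= K * inv_sqrt c v) -> avg_integrable V M g.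
Proof.
move=> mg gK.
have mV : measurable V := compact_measurable (density_compact VM).
apply: (@le_integrable _ _ _ (@lebesgue_measure R) V mV _ (EFin \o (fun v => M v * (K * inv_sqrt c v)))); last first.
- by apply: avg_integrableZ => //; exact: avg_integrable_inv_sqrt.
- move=> v Vv /=; rewrite lee_fin !normrM ler_wpM2l//.
  by rewrite (le_trans (gK v))// -normrM ler_norm.
- apply/measurable_EFinP; apply: measurable_funM; first exact: (M_measurable VM).
  exact: measurable_funTS.
Qed.

Lemma avg_integrable_bounded_fun2 u z : bounded_fun2 u -> measurable_fun setT (u z) -> avg_integrable V M (u z).
Proof.
move=> [B HB] mu; apply: (@avg_integrable_bounded _ _ _ VM _ B); first exact: measurable_funTS.
by move=> v _; exact: HB.
Qed.

Lemma avg_integrable_slope S u z : bounded_holder S -> bounded_fun2 u -> transport_level S u ->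
  measurable_fun setT (S z) -> measurable_fun setT (u z) ->
  avg_integrable V M (slope S u z).
Proof.
move=> nS bu hu mS mu; have [K K0 HK] := level_slope_le nS bu hu.
by apply: (@avg_integrable_inv_sqrt_dominated _ K); first exact: measurable_slope.
Qed.

(** The slope is dominated by the integrable weight |v - c|^(-1/2). *)
Lemma level_avg_derive S u : bounded_holder S -> bounded_fun2 u -> transport_level S u ->
  (forall z, measurable_fun setT (S z)) -> (forall z, measurable_fun setT (u z)) ->
  (forall z, is_derive z 1 (fun z => avg V M (u z)) (avg V M (slope S u z))) /\
  exists B, forall z, `|avg V M (slope S u z)| <= B.
Proof.
move=> nS bu hu mS mu; have [K K0 HK] := level_slope_le nS bu hu.
have ws z : avg_integrable V M (slope S u z) by exact: avg_integrable_slope.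
split.
  apply: (@derive_avg _ _ _ VM u (slope S u) (fun v => K * inv_sqrt c v) c) => //.
  - by move=> z; exact: avg_integrable_bounded_fun2.
  - by apply: avg_integrableZ => //; exact: avg_integrable_inv_sqrt.
  - by move=> v _ vc z; apply: hu.1.
have [A A0 HA] := avg_dist_inv_sqrt VM.
exists (K * A) => z; rewrite -[X in `|X|]subr0 -(avg_cst VM 0).
apply: (HA c) => //; first exact: avg_integrable_cst.
by move=> v Vv vc; rewrite subr0.
Qed.

(** |v - c| |u'| is bounded, so increments of u are of order
    sqrt (|x - y| / |v - c|). *)
Lemma level_avg_bounded_holder S u : bounded_fun2 S -> bounded_fun2 u -> transport_level S u ->
  (forall z, measurable_fun setT (u z)) ->
  bounded_holder (fun z _ : R => avg V M (u z)).
Proof.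
move=> bS bu hu mu; have [B HB] := bu.
have [Bk _] := k_holder.
have [B' HB'] : bounded_fun2 (fun z v => S z v - k z * u z v).
  have [B1 H1] := bS; have [B2 H2] := bounded_fun2M Bk bu.
  exists (B1 + B2) => z v; apply: (le_trans (ler_normB _ _)).
  by apply: lerD; [exact: H1|exact: H2].
have [A A0 HA] := avg_dist_inv_sqrt VM.
have wu z : avg_integrable V M (u z) by exact: avg_integrable_bounded_fun2.
split.
  exists (B + 0) => z _; rewrite addr0.
  rewrite -(avg_cst VM B) -[X in `|X|]subr0 -(avg_cst VM 0).
  by apply: (@avg_norm_le _ _ _ VM c) => //; try exact: avg_integrable_cst; move=> v _ _; rewrite subr0.
have B0 : 0 <= B by exact: le_trans (HB 0 0).
have B'0 : 0 <= B' by exact: le_trans (HB' 0 0).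
exists (Num.sqrt (2 * B * B') * A) => _ x y.
rewrite [leRHS]mulrAC -sqrtrM ?mulr_ge0// -[X in Num.sqrt X]mulrA.
apply: (HA c) => // v Vv vc.
have vc0 : v - c != 0 by rewrite subr_eq0.
apply: le_sqrt_interpolation => //.
- by rewrite mulr_ge0.
- by rewrite normr_gt0.
- by rewrite (le_trans (ler_normB _ _))// mulr_natl mulr2n lerD.
rewrite mulrC -ler_pdivlMr ?normr_gt0// mulrAC.
apply: (@lipschitz_of_derive R (u ^~ v)) => t.
exists (slope S u t v); first exact: level_derive.
rewrite ler_pdivlMr ?normr_gt0// -normrM mulrC.
have -> : (v - c) * slope S u t v = S t v - k t * u t v by rewrite -(slope_eq t v hu); ring.
exact: HB'.
Qed.

(** For v = c this is the derivative of S / rate p, with S' and p1 standing for the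
    derivatives of S in z and of p. *)
Definition level_derivative (S' : R -> R -> R) (p1 : R -> R) S u z v : R :=
  if v == c then (S' z c + r * p1 z * u z c) / k z else slope S u z v.

Lemma measurable_level_derivative S' p1 S u z : measurable_fun setT (S z) ->
  measurable_fun setT (u z) -> measurable_fun setT (level_derivative S' p1 S u z).
Proof.
move=> mS mu; have ms := measurable_slope mS mu.
have -> : [set: R] = [set c] `|` ~` [set c] by rewrite setUv.
have mc : measurable [set c] by exact: measurable_set1.
apply/measurable_funU => //; first exact: measurableC.
split; first exact: measurable_fun_set1.
apply: (@eq_measurable_fun _ _ _ _ _ (slope S u z)).
  by move=> v; rewrite inE/= /level_derivative => /eqP/negbTE ->.
exact: measurable_funTS.
Qed.

(** Differentiating the equation, u' solves the equation with source S' + r p' u.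
    For fixed v <> c it is bounded in z by [level_slope_le], so the maximum
    principle applies and gives a bound uniform in v. *)
Lemma level_derivativeP S' p1 S u : bounded_holder S -> bounded_fun2 u -> transport_level S u ->
  (forall z : R, is_derive z 1 p (p1 z)) ->
  (forall z v, is_derive z 1 (S ^~ v) (S' z v)) ->
  bounded_fun2 (fun z v => S' z v + r * p1 z * u z v) ->
  [/\ transport_level (fun z v => S' z v + r * p1 z * u z v) (level_derivative S' p1 S u),
      bounded_fun2 (level_derivative S' p1 S u) &
      forall z v, is_derive z 1 (u ^~ v) (level_derivative S' p1 S u z v)].
Proof.
move=> nS bu hu dp dS [B1 HB1].
have k0 z : 0 < k z by exact: lt_le_trans (k_ge1 z).
have dk (z : R) : is_derive z 1 k (- (r * p1 z)).
  by have := derB (der_cst (1 + r) z) (derMl r (dp z)); rewrite sub0r; apply.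
have level_derivativeE v : v != c -> (level_derivative S' p1 S u) ^~ v = (slope S u) ^~ v.
  by move=> /negbTE vc; apply/funext => z; rewrite /level_derivative vc.
have hn : transport_level (fun z v => S' z v + r * p1 z * u z v) (level_derivative S' p1 S u).
  split.
    move=> z v vc; rewrite (level_derivativeE v vc).
    apply: (is_derive_eq (derMr (v - c)^-1 (derB (dS z v) (derM (dk z) (hu.1 z v vc))))).
    rewrite /slope /level_derivative (negbTE vc) /slope; field.
    by rewrite subr_eq0.
  by move=> z; rewrite /level_derivative eqxx mulrC divfK ?gt_eqF.
have [K K0 HK] := level_slope_le nS bu hu.
split => //.
- exists B1 => z v.
  apply: (@max_principle_abs R (v - c) B1
    (Num.max (K * inv_sqrt c v) B1) k (fun z => level_derivative S' p1 S u z v)) => //.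
    move=> y; exists (slope (fun z v => S' z v + r * p1 z * u z v) (level_derivative S' p1 S u) y v).
      by move=> vc; exact: level_derive.
    by rewrite slope_eq.
  move=> y; rewrite /level_derivative; case: eqVneq => [->|vc]; rewrite le_max; last by rewrite HK.
  apply/orP; right; rewrite normrM normfV ler_pdivrMr ?normr_gt0 ?gt_eqF//.
  by rewrite (le_trans (HB1 y c))// ler_peMr ?(le_trans _ (HB1 0 0))// gtr0_norm.
- move=> z v; have [->|vc] := eqVneq v c; last first.
    by rewrite /level_derivative (negbTE vc); exact: hu.1.
  have -> : u ^~ c = (fun z => S z c * (k z)^-1).
    by apply/funext => y; rewrite -hu.2 mulrC mulKf// gt_eqF.
  have dV : is_derive z 1 (fun y => (k y)^-1) ((k z ^+ 2)^-1 * (r * p1 z)).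
    apply: (is_derive_eq (@is_deriveV R k z _ 1 (lt0r_neq0 (k0 z)) (dk z))).
    by rewrite scalerN scaleNr opprK.
  apply: (is_derive_eq (derM (dS z c) dV)).
  rewrite /level_derivative eqxx -(hu.2 z).
  by field; rewrite gt_eqF.
Qed.

(** For v0 <> c the difference of u at v and v0 solves an equation with small
    source; for v0 = c, u at v is close to S / rate p by the estimate of the
    residual, and u at c is equal to it. *)
Lemma level_velocity_ucont S u (v0 : R) : bounded_holder S -> bounded_fun2 u -> transport_level S u ->
  velocity_ucont S v0 -> velocity_ucont u v0.
Proof.
move=> nS bu hu cS e e0.
have e2 : 0 < e / 2 by rewrite divr_gt0.
have [v0c|v0c] := eqVneq v0 c.
- have [K K0 HK] := level_residual_le nS bu hu.
  have K1 : 0 < K + 1 by rewrite ltr_wpDl.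
  pose d := e / 2 / (K + 1).
  have d0 : 0 < d by rewrite divr_gt0.
  near=> v => z.
  have h1 : `|v - c| <= d ^+ 2.
    rewrite distrC -v0c; near: v.
    have /cvgrPdist_le := @cvg_id _ (nbhs v0); apply; exact: exprn_gt0.
  have h2 : `|S z v - S z v0| <= e / 2 by move: z; near: v; exact: cS.
  have h3 : `|k z * (u z v - u z v0)| <= e.
    have -> : k z * (u z v - u z v0) = (S z v - S z v0) - (S z v - k z * u z v).
      by rewrite v0c -hu.2; ring.
    rewrite (splitr e); apply: (le_trans (ler_normB _ _)); apply: lerD => //.
    apply: (le_trans (HK z v)).
    apply: (@le_trans _ _ (K * d)).
      by rewrite ler_wpM2l//; apply: sqrtr_le_of_sqr => //; exact: ltW.
    apply: (@le_trans _ _ ((K + 1) * d)); first by rewrite ler_wpM2r ?(ltW d0)// lerDl.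
    by rewrite /d mulrC divfK// gt_eqF.
  apply: le_trans h3; rewrite normrM; apply: ler_peMl => //.
  exact: le_trans (k_ge1 z) (ler_norm _).
- have [K' K'0 HK'] := level_slope_le nS bu hu.
  pose Q := K' * inv_sqrt c v0 + 1.
  have Q0 : 0 < Q by rewrite ltr_wpDl// mulr_ge0// inv_sqrt_ge0.
  have qd : 0 < e / 2 / Q by rewrite divr_gt0.
  have v00 : v0 - c != 0 by rewrite subr_eq0.
  have [B HB] := bu.
  near=> v => z.
  have h5 : `|v0 - v| <= e / 2 / Q.
    by near: v; have /cvgrPdist_le := @cvg_id _ (nbhs v0); apply.
  have h6 y : `|S y v - S y v0| <= e / 2 by move: y; near: v; exact: cS.
  apply: (@max_principle_abs R (v - c) e (2 * B) k (fun z => u z v - u z v0)) => //.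
    move=> y; exists (slope S u y v - slope S u y v0).
      by move=> vc; apply: derB; [exact: level_derive|exact: level_derive].
    have -> : (v - c) * (slope S u y v - slope S u y v0) + k y * (u y v - u y v0)
       = (S y v - S y v0) + (v0 - v) * slope S u y v0.
      by rewrite -(slope_eq y v hu) -(slope_eq y v0 hu); ring.
    rewrite (splitr e); apply: (le_trans (ler_normD _ _)); apply: lerD => //.
    rewrite normrM; apply: (@le_trans _ _ (e / 2 / Q * Q)).
      apply: ler_pM => //; apply: (le_trans (HK' y v0)).
      by rewrite lerDl.
    by rewrite divfK// gt_eqF.
  by move=> y; rewrite (le_trans (ler_normB _ _))// mulr_natl mulr2n lerD.
Unshelve. all: end_near. Qed.

End Levels.

(** * Waves are twice differentiable *)

Section WaveRegularity.
Context {R : realType}.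
Variables (r : R) (V : set R) (M : R -> R).
Hypothesis r_gt0 : 0 < r.
Hypothesis VM : velocity_density V M.
Implicit Types (c l : R) (p : R -> R) (z v : R).

(** The average p of h is differentiable; then h has a bounded derivative h1, whose
    average p' is therefore Hoelder, and the argument applies again to h1.  Then
    p'' is Hoelder as the average of h2, and the joint continuity of h2 follows. *)
Lemma wave_regularity c p : wave r V M c p -> exists h h1 h2 : R -> R -> R,
  [/\ forall v, is_response r (v - c) p (h ^~ v),
      forall z, avg_integrable V M (h z) /\ p z = avg V M (h z),
      (forall z v, is_derive z 1 (h ^~ v) (h1 z v)) /\
      (forall z v, is_derive z 1 (h1 ^~ v) (h2 z v)) &
      [/\ continuous (fun q : R * R => h q.1 q.2),
          continuous (fun q : R * R => h1 q.1 q.2) &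
          continuous (fun q : R * R => h2 q.1 q.2)]].
Proof.
move=> [fp p0 pT]; have [cp up pnd] := fp.
have [C _ HC] := front_map_moduli r_gt0 VM.
have np : bounded_holder (fun z _ : R => p z).
  split; first by exists 1 => z _; have /andP[? ?] := up z; rewrite ger0_norm.
  by exists C => _ x y; rewrite /= pT (pT y); exact: (HC c p fp).1.
pose h z v := response r (v - c) p z.
have Rh v : is_response r (v - c) p (h ^~ v) by exact: responseP.
have mh z : measurable_fun setT (h z).
  apply: nonincreasing_measurable => // v1 v2 v12.
  apply: (response_nonincreasing_velocity r_gt0 cp up pnd (Rh v1) (Rh v2)).
  by rewrite lerD2r.
have bh : bounded_fun2 h.
  by exists 1 => z v; have [/andP[? ?] _] := Rh v z; rewrite ger0_norm.
have wh z : avg_integrable V M (h z) by exact: avg_integrable_response.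
have ph z : p z = avg V M (h z) by exact: pT.
pose S0 : R -> R -> R := fun z _ => p z.
have mS0 z : measurable_fun setT (S0 z) by exact: measurable_cst.
have l0 : transport_level r c p S0 h.
  split=> [z v vc|z].
    have [_ [d hd e]] := Rh v z.
    have vc0 : v - c != 0 by rewrite subr_eq0.
    apply: (is_derive_eq (hd vc0)); rewrite /slope /S0 -e addrK mulrC mulKf//.
  have [_ [d hd]] := Rh c z; by rewrite subrr mul0r add0r.
have nh := level_bounded_holder r_gt0 up np np bh l0.
have [dp [B1 HB1]] := level_avg_derive r_gt0 VM up np np bh l0 mS0 mh.
pose p1 z := avg V M (slope r c p S0 h z).
have {}dp (z : R) : is_derive z 1 p (p1 z).
  have -> : p = (fun z => avg V M (h z)) by apply/funext => y; exact: ph.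
  exact: dp.
have bp1 : bounded_fun2 (fun z _ : R => p1 z) by exists B1 => z _; exact: HB1.
have bS1 : bounded_fun2 (fun z v => p1 z + r * p1 z * h z v).
  by apply: bounded_fun2D => //; apply: bounded_fun2M => //; apply: bounded_fun2M => //; exact: bounded_fun2_cst.
have [l1 bh1 dh] := level_derivativeP r_gt0 up np np bh l0 dp (fun z _ => dp z) bS1.
pose S1 z v := p1 z + r * p1 z * h z v.
pose h1 := level_derivative r c p (fun z _ => p1 z) p1 S0 h.
have mh1 z : measurable_fun setT (h1 z) by exact: measurable_level_derivative.
have mS1 z : measurable_fun setT (S1 z).
  by apply: measurable_funD => //; apply: measurable_funM.
have p1E z : p1 z = avg V M (h1 z).
  apply: (avg_eq VM (c := c)).
  - exact: (avg_integrable_slope r_gt0 VM up np np bh l0).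
  - exact: avg_integrable_bounded_fun2.
  - by move=> v _ vc; rewrite /h1 /level_derivative (negbTE vc).
have np1 : bounded_holder (fun z _ : R => p1 z).
  have := level_avg_bounded_holder VM np bS1 bh1 l1 mh1.
  by congr bounded_holder; apply/funext => z; apply/funext => _; rewrite p1E.
have nS1 : bounded_holder S1.
  by apply: bounded_holderD => //; apply: bounded_holderM => //; apply: bounded_holderM => //; exact: bounded_holder_cst.
have nh1 := level_bounded_holder r_gt0 up np nS1 bh1 l1.
have [dp1 [B2 HB2]] := level_avg_derive r_gt0 VM up np nS1 bh1 l1 mS1 mh1.
pose p2 z := avg V M (slope r c p S1 h1 z).
have {}dp1 (z : R) : is_derive z 1 p1 (p2 z).
  have -> : p1 = (fun z => avg V M (h1 z)) by apply/funext => y; exact: p1E.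
  exact: dp1.
have bp2 : bounded_fun2 (fun z _ : R => p2 z) by exists B2 => z _; exact: HB2.
pose S1' z v := p2 z + (r * p1 z * h1 z v + r * p2 z * h z v).
have dS1 z v : is_derive z 1 (S1 ^~ v) (S1' z v).
  exact (derD (dp1 z) (@derM R (fun z => r * p1 z) (h ^~ v) z _ _ (derMl r (dp1 z)) (dh z v))).
have bS2 : bounded_fun2 (fun z v => S1' z v + r * p1 z * h1 z v).
  have brp1 : bounded_fun2 (fun z v => r * p1 z * h1 z v).
    by apply: bounded_fun2M => //; apply: bounded_fun2M => //; exact: bounded_fun2_cst.
  apply: bounded_fun2D => //; apply: bounded_fun2D => //; apply: bounded_fun2D => //.
  by apply: bounded_fun2M => //; apply: bounded_fun2M => //; exact: bounded_fun2_cst.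
have [l2 bh2 dh1] := level_derivativeP r_gt0 up np nS1 bh1 l1 dp dS1 bS2.
pose h2 := level_derivative r c p S1' p1 S1 h1.
have mh2 z : measurable_fun setT (h2 z) by exact: measurable_level_derivative.
have p2E z : p2 z = avg V M (h2 z).
  apply: (avg_eq VM (c := c)).
  - exact: (avg_integrable_slope r_gt0 VM up np nS1 bh1 l1).
  - exact: avg_integrable_bounded_fun2.
  - by move=> v _ vc; rewrite /h2 /level_derivative (negbTE vc).
have np2 : bounded_holder (fun z _ : R => p2 z).
  have := level_avg_bounded_holder VM np bS2 bh2 l2 mh2.
  by congr bounded_holder; apply/funext => z; apply/funext => _; rewrite p2E.
have nS2 : bounded_holder (fun z v => S1' z v + r * p1 z * h1 z v).
  have nr (q : R -> R) (w : R -> R -> R) : bounded_holder (fun z _ : R => q z) -> bounded_holder w ->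
      bounded_holder (fun z v => r * q z * w z v).
    by move=> nq nw; apply: bounded_holderM => //; apply: bounded_holderM => //; exact: bounded_holder_cst.
  by apply: bounded_holderD; [apply: bounded_holderD => //; apply: bounded_holderD|]; exact: nr.
have nh2 := level_bounded_holder r_gt0 up np nS2 bh2 l2.
have ucr (q : R -> R) (w : R -> R -> R) v0 : bounded_fun2 (fun z _ : R => q z) -> bounded_fun2 w ->
    velocity_ucont w v0 -> velocity_ucont (fun z v => r * q z * w z v) v0.
  move=> bq bw uw; apply: velocity_ucontM => //; last exact: (velocity_ucont_cst (fun z => r * q z)).
  by apply: bounded_fun2M => //; exact: bounded_fun2_cst.
have uh v0 : velocity_ucont h v0.
  exact: (level_velocity_ucont r_gt0 up np np bh l0 (velocity_ucont_cst p _)).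
have uh1 v0 : velocity_ucont h1 v0.
  apply: (level_velocity_ucont r_gt0 up np nS1 bh1 l1).
  by apply: velocity_ucontD; [exact: (velocity_ucont_cst p1)|exact: ucr].
have uh2 v0 : velocity_ucont h2 v0.
  apply: (level_velocity_ucont r_gt0 up np nS2 bh2 l2).
  apply: velocity_ucontD; last exact: ucr.
  apply: velocity_ucontD; first exact: (velocity_ucont_cst p2).
  by apply: velocity_ucontD; exact: ucr.
exists h, h1, h2; split => //; split; exact: jointly_continuous_of_velocity_ucont.
Qed.

End WaveRegularity.

(** * Waves and travelling waves *)

Section Correspondence.
Context {R : realType}.
Variables (r : R) (V : set R) (M : R -> R).
Hypothesis r_gt0 : 0 < r.
Hypothesis VM : velocity_density V M.
Implicit Types (c : R) (p : R -> R) (f h : R -> R -> R) (z v x t : R).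

Lemma jointly_continuous_density_mul h :
  continuous (fun q : R * R => h q.1 q.2) ->
  jointly_continuous V (fun z v => M v * h z v).
Proof.
move=> ch; apply/subspace_continuousP => -[z v] /= Vv.
apply: cvgM; last by apply: cvg_within_filter; exact: ch.
have := density_continuous VM => /subspace_continuousP/(_ v Vv).
apply: cvg_comp => A /=.
rewrite /within /= => -[e /= e0 He].
exists (setT, ball v e); first by split; [exact: filterT|exact: nbhsx_ballx].
by move=> [z' v'] /= [_ b] Vv'; exact: He.
Qed.

Lemma dz_eq f (f1 : R -> R -> R) : (forall z v, is_derive z 1 (f ^~ v) (f1 z v)) ->
  dz f = f1.
Proof.
move=> df; apply/funext => z; apply/funext => v; rewrite /dz derive1E.
exact: derive_val.
Qed.

Lemma density_of_profile (g : R -> R) : density V (fun v => M v * g v) = avg V M g.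
Proof. by []. Qed.

Lemma travelling_wave_of_wave c p : 0 <= c -> wave r V M c p ->
  exists f, [/\ travelling_wave r V M c f, profile_equation r V M c f &
    forall z v, V v -> dz f z v <= 0].
Proof.
move=> c0 w; have [fp p0 pT] := w; have [cp up pnd] := fp.
have [pl pr] := wave_cvg r_gt0 VM w.
have [h [h1 [h2 [Rh wh [dh dh1] [ch ch1 ch2]]]]] := wave_regularity r_gt0 VM w.
pose f z v := M v * (1 - h z v).
have df z v : is_derive z 1 (f ^~ v) (M v * - h1 z v).
  apply: derMl; rewrite -sub0r; exact: (derB (der_cst 1 z) (dh z v)).
have dzf : dz f = fun z v => M v * - h1 z v by exact: dz_eq.
have ddzf : dz (dz f) = fun z v => M v * - h2 z v.
  by rewrite dzf; apply: dz_eq => z v; apply: derMl; exact: derN.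
have fM z v : V v -> 0 <= f z v <= M v.
  move=> /(density_ge0 VM) Mv; have [/andP[? ?] _] := Rh v z.
  by rewrite /f mulr_ge0 ?subr_ge0//= ler_piMr// gerBl.
have rho z : density V (f z) = 1 - p z.
  have [wz pz] := wh z.
  by rewrite density_of_profile avgB//; [rewrite avg_cst// -pz|exact: avg_integrable_cst].
have pe : profile_equation r V M c f.
  move=> z v Vv; rewrite dzf /kinetic_rhs rho /f.
  have [_ [d hd e]] := Rh v z.
  have {e} e : (v - c) * h1 z v + rate r p z * h z v = p z.
    have [vc|vc] := eqVneq (v - c) 0; last by rewrite (der_unique (dh z v) (hd vc)).
    by move: e; rewrite vc !mul0r.
  have {}e : (v - c) * h1 z v = p z - rate r p z * h z v by rewrite -e addrK.
  rewrite mulrN mulrN mulrCA e /rate; ring.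
exists f; split => //.
- split => //.
  + split.
    * by move=> z v _; case: (df z v).
    * move=> z v _; rewrite dzf.
      have [] // : is_derive z 1 (fun y => M v * - h1 y v) (M v * - h2 z v).
      by apply: derMl; exact: derN.
    * apply: (@jointly_continuous_density_mul (fun z v => 1 - h z v)).
      by move=> q; apply: cvgB; [exact: cvg_cst|exact: ch].
    * rewrite dzf; apply: (@jointly_continuous_density_mul (fun z v => - h1 z v)).
      by move=> q; apply: cvgN; exact: ch1.
    * rewrite ddzf; apply: (@jointly_continuous_density_mul (fun z v => - h2 z v)).
      by move=> q; apply: cvgN; exact: ch2.
  + move=> v Vv.
    have l0 : (0 : R) <= 0 <= (1 : R) by rewrite lexx ler01.
    have l1 : (0 : R) <= 1 <= (1 : R) by rewrite lexx ler01.
    have e0 : const_response r 0 = 0 by rewrite /const_response mul0r.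
    have e1 : const_response r 1 = 1 by rewrite /const_response mulr1 addrK divr1.
    have hl := response_cvg (PF := proper_ninfty_nbhs) r_gt0 shiftable_ninfty fp (Rh v) l0 pl.
    have hr := response_cvg (PF := proper_pinfty_nbhs) r_gt0 shiftable_pinfty fp (Rh v) l1 pr.
    rewrite e0 in hl; rewrite e1 in hr.
    split.
      rewrite -[X in _ --> X]mulr1 -[X in M v * X]subr0.
      by apply: cvgM; [exact: cvg_cst|apply: cvgB; [exact: cvg_cst|exact: hl]].
    rewrite -[X in _ --> X](mulr0 (M v)) -[X in M v * X](subrr 1).
    by apply: cvgM; [exact: cvg_cst|apply: cvgB; [exact: cvg_cst|exact: hr]].
  + move=> t x v t0 Vv.
    have dt : is_derive t 1 (fun s => f (x - c * s) v) (dz f (x - c * t) v * - c).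
      rewrite dzf; apply: (@der_comp R (f ^~ v) (fun s => x - c * s) t _ (- c) (df _ _)).
      by have := derB (der_cst x t) (derMl c (der_id t)); rewrite sub0r mulr1; apply.
    have dx : is_derive x 1 (fun y => f (y - c * t) v) (dz f (x - c * t) v).
      by rewrite dzf; apply: (@der_shift R (f ^~ v) x (- (c * t))); exact: df.
    split; [by case: dt|by case: dx|].
    rewrite !derive1E (@derive_val _ _ _ _ _ _ _ dt) (@derive_val _ _ _ _ _ _ _ dx).
    by rewrite -pe//; ring.
- move=> z v Vv; rewrite dzf mulrN oppr_le0 mulr_ge0 ?(density_ge0 VM)//.
  apply: (ge0_of_derive_nondecreasing _ (dh z v)).
  exact: (response_nondecreasing r_gt0 cp up pnd (Rh v)).
Qed.

(** The equation at time 0 is the profile equation, and h = 1 - f / M solves the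
    response equation wherever M > 0.  Division by M v = 0 gives h = 1 there,
    a constant without weight in the averages. *)
Lemma sub_front_of_travelling_wave c f : travelling_wave r V M c f ->
  exists q, [/\ front q, (forall z, q z <= front_map r V M c q z),
     q z @[z --> -oo] --> (0 : R) & (exists z, 0 < q z)].
Proof.
move=> [c0 [df _ cf _ _] fM fl ks].
have mV : measurable V := compact_measurable (density_compact VM).
have mf z : measurable_fun V (f z).
  apply: subspace_continuous_measurable_fun => //.
  apply/subspace_continuousP => v Vv.
  have /subspace_continuousP/(_ (z, v) Vv) H := cf.
  apply: (@cvg_comp _ _ _ (fun v' => (z, v')) (fun q : R * R => f q.1 q.2) _ _ _ _ H).
  move=> A; rewrite /within /=.
  move=> [[P Q] /= [Pz Qv] PQ].
  apply: filterS Qv => v' Qv' Vv'.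
  by apply: (PQ (z, v')) => //; split => //; exact: nbhs_singleton.
pose g z v := f z v / M v.
have g01 z v : V v -> 0 <= g z v <= 1.
  move=> Vv; have /andP[f0 fM1] := fM z v Vv; have Mv := density_ge0 VM Vv.
  rewrite /g divr_ge0//=.
  have [e|Mv0] := eqVneq (M v) 0; first by rewrite e invr0 mulr0.
  by rewrite ler_pdivrMr ?mul1r// lt_def Mv0.
have wg z : avg_integrable V M (g z).
  apply: (avg_integrable_bounded VM (B := 1)).
    apply: measurable_funM => //.
    apply: (@measurableT_comp _ _ _ _ _ _ (fun x : R => x^-1)); last exact: M_measurable VM.
    by apply: (@measurable_off_point _ _ 0) => x x0; apply: cvgV => //; exact: cvg_id.
  by move=> v Vv; have /andP[? ?] := g01 z v Vv; rewrite ger0_norm.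
pose h z v := 1 - g z v.
pose p z := avg V M (h z).
have wh z : avg_integrable V M (h z) by exact: avg_integrableB (avg_integrable_cst VM 1) (wg z).
have rho z : density V (f z) = 1 - p z.
  rewrite /p /h avgB ?avg_cst ?opprB ?(addrC 1) ?subrK//; last exact: avg_integrable_cst.
  rewrite /density /avg; apply: eq_Rintegral => v; rewrite inE => Vv.
  have /andP[f0 fM1] := fM z v Vv.
  rewrite /g; have [e|Mv0] := eqVneq (M v) 0; last by rewrite mulrC divfK.
  by rewrite e mul0r; apply/le_anti; rewrite f0 -{1}e fM1.
have pe z v : V v -> (v - c) * dz f z v = kinetic_rhs r V M (f z) v.
  move=> Vv; have [_ _] := ks 0 z v (lexx 0) Vv.
  have dfz : is_derive z 1 (f ^~ v) (dz f z v) by apply: derivable_is_derive; exact: df.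
  have z0 : z - c * 0 = z by rewrite mulr0 subr0.
  have dt : is_derive (0 : R) 1 (fun s => f (z - c * s) v) (dz f z v * - c).
    apply: (@der_comp R (f ^~ v) (fun s => z - c * s) 0 _ (- c)); first by rewrite z0.
    by have := derB (der_cst z 0) (derMl c (der_id 0)); rewrite sub0r mulr1; apply.
  have dx : is_derive z 1 (fun y => f (y - c * 0) v) (dz f z v).
    by apply: (@der_shift R (f ^~ v) z (- (c * 0))); rewrite z0.
  rewrite !derive1E (@derive_val _ _ _ _ _ _ _ dt) (@derive_val _ _ _ _ _ _ _ dx) z0 => <-.
  by ring.
apply: (@sub_front_of_profile _ _ _ _ r_gt0 VM c h p) => //.
- by move=> z v Vv; have /andP[? ?] := g01 z v Vv; rewrite /h subr_ge0 gerBl; apply/andP.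
- move=> v Vv Mv z; split.
    by have /andP[? ?] := g01 z v Vv; rewrite /h subr_ge0 gerBl; apply/andP.
  have dfz : is_derive z 1 (f ^~ v) (dz f z v) by apply: derivable_is_derive; exact: df.
  exists (- (dz f z v / M v)).
    move=> _; rewrite -sub0r; exact: derB (der_cst 1 z) (derMr (M v)^-1 dfz).
  rewrite mulrN mulrA pe// /kinetic_rhs rho /rate /h /g; field.
  by rewrite gt_eqF.
- by move=> z v e; rewrite /h /g e invr0 mulr0 subr0.
- move=> v Vv Mv; have [fl1 fl2] := fl v Vv; split.
    rewrite -[X in _ --> X](subrr 1) -[X in _ --> _ - X](@divff _ (M v)) ?gt_eqF//.
    by apply: cvgB; [exact: cvg_cst|apply: cvgM => //; exact: cvg_cst].
  rewrite -[X in _ --> X]subr0 -[X in _ --> _ - X](mul0r (M v)^-1).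
  by apply: cvgB; [exact: cvg_cst|apply: cvgM => //; exact: cvg_cst].
Qed.

End Correspondence.

Theorem theorem1p2 (R : realType) (r : R) (V : set R) (M : R -> R) (D : R)
  (r_gt0 : 0 < r)
  (V_compact : compact V)
  (V_sym : [set - v | v in V] = V)
  (M_cont : {within V, continuous M})
  (M_ge0 : forall v : R, V v -> 0 <= M v)
  (V_supp : V = supp_on V M)
  (M_mass : (\int[@lebesgue_measure R]_(v in V) (M v)%:E = 1%:E)%E)
  (M_mean : (\int[@lebesgue_measure R]_(v in V) (v * M v)%:E = 0%:E)%E)
  (M_var : (\int[@lebesgue_measure R]_(v in V) (v ^+ 2 * M v)%:E = D%:E)%E) :
  exists cstar : R,
    [/\ 0 < cstar < sup V,
        forall c : R, cstar <= c < sup V ->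
          exists f : R -> R -> R,
            [/\ travelling_wave r V M c f,
                profile_equation r V M c f &
                forall z v : R, V v -> dz f z v <= 0] &
        0 < inf [set M v | v in V] ->
          forall c : R, 0 <= c < cstar ->
            ~ exists f : R -> R -> R,
                travelling_wave r V M c f /\ positive_profile V f].
Proof.
have VM : velocity_density V M by split.
have [C C1 HC] := front_map_moduli r_gt0 VM.
have [W W0 HW] := velocities_bounded VM.
have Vub v : V v -> v <= sup V.
  move=> Vv; apply: ub_le_sup => //; exists W => v' /HW.
  by apply: le_trans; exact: ler_norm.
have supV : 0 < sup V.
  rewrite ltNge; apply/negP => s0.
  have V0 : V `<=` [set 0].
    move=> v Vv /=; apply/le_anti/andP; split; first exact: le_trans (Vub v Vv) s0.
    rewrite -oppr_le0; apply: le_trans s0; apply: Vub.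
    by rewrite -V_sym; exists v.
  move: M_mass; rewrite (integral_Sset1 _ V0) => /esym/eqP.
  by rewrite eqe oner_eq0.
pose S := [set c : R | 0 <= c < sup V /\ exists p, wave r V M c p].
have [c0 c0V c0w] := wave_near_max_speed r_gt0 VM C1 HC supV Vub.
have Sc0 : S c0 by [].
have Sinf : has_inf S by split; [exists c0|exists 0 => c [/andP[]]].
have Slb c : S c -> inf S <= c by move=> Sc; apply: ge_inf => //; case: Sinf.
have inf0 : 0 <= inf S by apply: lb_le_inf; [exists c0|move=> c [/andP[]]].
have infV : inf S < sup V.
  by apply: le_lt_trans (Slb _ Sc0) _; case/andP: c0V.
have [pstar wstar] : exists p, wave r V M (inf S) p.
  apply: (wave_speed_closed r_gt0 VM C1 HC) => e e0.
  have [c [c01 [p wp]] ce] := inf_adherent e0 Sinf.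
  exists c, p; split => //.
  have := Slb c (conj c01 (ex_intro _ p wp)).
  by move=> h; rewrite distrC ger0_norm ?subr_ge0//; lra.
have infp : 0 < inf S.
  rewrite lt_def inf0 andbT; apply/eqP => e.
  by move: wstar; rewrite e; exact: no_wave_zero.
exists (inf S); split; first by rewrite infp.
- move=> c /andP[c1 c2].
  have [p wp] := wave_speed_up r_gt0 VM C1 HC wstar c1.
  by apply: (travelling_wave_of_wave r_gt0 VM _ wp); exact: le_trans c1.
- move=> _ c /andP[c1 c2] [f [tw _]].
  have [q [fq qT q0 q1]] := sub_front_of_travelling_wave r_gt0 VM tw.
  have wc := wave_of_sub_front r_gt0 VM C1 HC fq qT q0 q1.
  have : S c by split => //; rewrite c1 (lt_trans c2).
  by move=> /Slb; rewrite leNgt c2.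
Qed.
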